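(* Let $(\mathcal{N},h)$ be a pseudo-Riemannian manifold of class $\mathcal{C}^2$ and of dimension $n$, let $\Omega$ be an open subset of $\mathbb{R}^m$, let $a\in\Omega$, and let $u:\Omega\to\mathcal{N}$ be a continuous map which is $\mathcal{C}^2$ and harmonic into $(\mathcal{N},h)$ on $\Omega\setminus\{a\}$. Then there exist $\alpha\in(0,1)$ and an open ball $B^m(a,R_1)\subset\Omega$, $R_1>0$, such that $u$ is in $\mathcal{C}^{0,\alpha}(B^m(a,R_1))$ and $|u|_{0,\alpha;B^m(a,R_1)}$ is finite. That is, there is a local chart $\psi:U\to\mathbb{R}^n$ of $\mathcal{N}$ around $u(a)$ with $u(B^m(a,R_1))\subset U$ and $$\sup_{x\in B^m(a,R_1)}|\psi(u(x))|+\sup_{x,y\in B^m(a,R_1),\,x\neq y}\frac{|\psi(u(x))-\psi(u(y))|}{|x-y|^\alpha}<\infty .$$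
   Context: $B^m(a,r)=\{x\in\mathbb{R}^m: |x-a|<r\}$. A pseudo-Riemannian manifold $(\mathcal{N},h)$ of dimension $n\ge1$ and signature $(p,q)$, $p+q=n$, is a smooth $n$-dimensional manifold with a section $h$ of the symmetric tensor product $T^*\mathcal{N}\odot T^*\mathcal{N}$ such that each $h_M$ is a nondegenerate symmetric bilinear form of signature $(p,q)$. It is of class $\mathcal{C}^k$ if its coefficients $h_{ij}(y)=h(\partial/\partial y^i,\partial/\partial y^j)$ in local charts are $\mathcal{C}^k$. In local coordinates the Christoffel symbols are $\Gamma^i_{jk}=\frac12 h^{il}\left(\frac{\partial h_{lk}}{\partial y^j}+\frac{\partial h_{jl}}{\partial y^k}-\frac{\partial h_{jk}}{\partial y^l}\right)$, where $(h^{ij})$ is the inverse matrix of $(h_{ij})$ (summation over repeated indices). A $\mathcal{C}^2$ map $u$ from an open subset of $\mathbb{R}^m$ (with its Euclidean metric) to $\mathcal{N}$ is harmonic into $(\mathcal{N},h)$ if, in local coordinates on $\mathcal{N}$ with $u\simeq(u^1,\dots,u^n)$, for every $i$, $\Delta u^i+\sum_{\mu=1}^m\Gamma^i_{jk}(u)\frac{\partial u^j}{\partial x^\mu}\frac{\partial u^k}{\partial x^\mu}=0$, where $\Delta=\sum_{\mu=1}^m\partial^2/(\partial x^\mu)^2$. *)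

(* Defs.v *)
(* MathComp-Analysis; R^m is 'rV[R]_m for an arbitrary R : realType. *)
From HB Require Import structures.
From mathcomp Require Import all_boot all_order all_algebra.
From mathcomp Require Import all_classical all_reals all_analysis.
Set Implicit Arguments.
Unset Strict Implicit.
Unset Printing Implicit Defensive.
Import Order.TTheory GRing.Theory Num.Theory.
Import numFieldNormedType.Exports.
Local Open Scope classical_set_scope.
Local Open Scope ring_scope.

(* The library norm on 'rV[R]_m is the sup norm; it induces the same topology
   and notion of differentiability as enorm, but not the same balls. *)
Definition enorm (R : realType) (m : nat) (x : 'rV[R]_m) : R :=
  Num.sqrt (\sum_(i < m) x 0 i ^+ 2).

Definition eball (R : realType) (m : nat) (a : 'rV[R]_m) (r : R) :
  set 'rV[R]_m := [set x | enorm (x - a) < r].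

Definition pderiv (R : realType) (m : nat) (W : normedModType R) (i : 'I_m)
  (f : 'rV[R]_m -> W) : 'rV[R]_m -> W := fun x => 'D_(delta_mx 0 i) f x.

(* f is of class C^k on A.  Meant for open A only: then continuity,
   differentiability and derivatives at points of A ignore the values of the
   total function f outside A. *)
Fixpoint Ck (R : realType) (m : nat) (W : normedModType R) (k : nat)
  (A : set 'rV[R]_m) (f : 'rV[R]_m -> W) : Prop :=
  match k with
  | 0 => forall x, A x -> {for x, continuous f}
  | k'.+1 => (forall x, A x -> differentiable f x) /\
             (forall i : 'I_m, Ck k' A (pderiv i f))
  end.

(* A homeomorphism cmap from the open set cdom onto an open subset of R^n, with
   inverse cinv.  The values of cmap outside cdom and of cinv outside
   cmap @` cdom are irrelevant. *)
Record chart (R : realType) (n : nat) (N : topologicalType) := Chart {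
  cdom : set N;
  cmap : N -> 'rV[R]_n;
  cinv : 'rV[R]_n -> N;
  open_cdom : open cdom;
  open_cimg : open (cmap @` cdom);
  cmapK : forall M, cdom M -> cinv (cmap M) = M;
  cmap_continuous : {within cdom, continuous cmap};
  cinv_continuous : {within cmap @` cdom, continuous cinv} }.

Definition cimg (R : realType) (n : nat) (N : topologicalType)
  (phi : chart R n N) : set 'rV[R]_n := cmap phi @` cdom phi.

Definition transition (R : realType) (n : nat) (N : topologicalType)
  (phi psi : chart R n N) : 'rV[R]_n -> 'rV[R]_n :=
  fun y => cmap psi (cinv phi y).

Definition smooth_compatible (R : realType) (n : nat) (N : topologicalType)
  (phi psi : chart R n N) : Prop :=
  forall k,
    Ck k (cmap phi @` (cdom phi `&` cdom psi)) (transition phi psi) /\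
    Ck k (cmap psi @` (cdom phi `&` cdom psi)) (transition psi phi).

(* matlas is a maximal smooth atlas: its members are the local charts. *)
Record smooth_manifold (R : realType) (n : nat) := SmoothManifold {
  mspace :> topologicalType;
  matlas : set (chart R n mspace);
  mspace_hausdorff : hausdorff_space mspace;
  mspace_second_countable : @second_countable mspace;
  matlas_cover : forall M, exists2 phi, matlas phi & cdom phi M;
  matlas_compatible : forall phi psi,
    matlas phi -> matlas psi -> smooth_compatible phi psi;
  matlas_maximal : forall phi,
    (forall psi, matlas psi -> smooth_compatible phi psi) -> matlas phi }.

Definition chart_at (R : realType) (n : nat) (N : smooth_manifold R n) (M : N)
  : set (chart R n N) := [set phi | matlas phi /\ cdom phi M].

(* A tangent vector at M is encoded by the family of its components in all the
   local charts around M, which transform by the differentials of the transition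
   maps; the entries for the other charts are set to 0.  Addition and scaling
   are those of functions. *)
Definition tangent (R : realType) (n : nat) (N : smooth_manifold R n) (M : N)
  : set (chart R n N -> 'rV[R]_n) :=
  [set v | (forall phi, ~ chart_at M phi -> v phi = 0) /\
           (forall phi psi, chart_at M phi -> chart_at M psi ->
              v psi = 'd (transition phi psi) (cmap phi M) (v phi))].

(* The coordinate vector d/dy^i of the chart phi at the point M. *)
Definition coord_vector (R : realType) (n : nat) (N : smooth_manifold R n)
  (phi : chart R n N) (M : N) (i : 'I_n) : chart R n N -> 'rV[R]_n :=
  fun psi => if `[< chart_at M psi >]
             then 'd (transition phi psi) (cmap phi M) (delta_mx 0 i) else 0.

(* Fields of bilinear forms on the tangent spaces; values of h M outside
   tangent M are irrelevant. *)
Definition form_field (R : realType) (n : nat) (N : smooth_manifold R n) :=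
  N -> (chart R n N -> 'rV[R]_n) -> (chart R n N -> 'rV[R]_n) -> R.

Definition symmetric_bilinear_at (R : realType) (n : nat)
  (N : smooth_manifold R n) (h : form_field N) (M : N) : Prop :=
  (forall v w, tangent M v -> tangent M w -> h M v w = h M w v) /\
  (forall (c : R) v v' w, tangent M v -> tangent M v' -> tangent M w ->
     h M (c *: v + v') w = c * h M v w + h M v' w).

Definition nondegenerate_at (R : realType) (n : nat) (N : smooth_manifold R n)
  (h : form_field N) (M : N) : Prop :=
  forall v, tangent M v -> (forall w, tangent M w -> h M v w = 0) -> v = 0.

(* There is an h M-orthogonal basis of the tangent space whose first p vectors
   have square 1 and whose last q vectors have square -1. *)
Definition has_signature_at (R : realType) (n : nat) (N : smooth_manifold R n)
  (h : form_field N) (p q : nat) (M : N) : Prop :=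
  (p + q)%N = n /\
  exists e : 'I_n -> chart R n N -> 'rV[R]_n,
    [/\ forall i, tangent M (e i),
        forall v, tangent M v ->
          exists! c : 'rV[R]_n, v = \sum_(i < n) c 0 i *: e i &
        forall i j, h M (e i) (e j) =
          if i == j then (if (i < p)%N then 1 else -1) else 0].

Definition metric_coef (R : realType) (n : nat) (N : smooth_manifold R n)
  (h : form_field N) (phi : chart R n N) (i j : 'I_n) : 'rV[R]_n -> R :=
  fun y => h (cinv phi y) (coord_vector phi (cinv phi y) i)
                          (coord_vector phi (cinv phi y) j).

Definition pseudo_riemannian (R : realType) (n : nat) (N : smooth_manifold R n)
  (p q : nat) (h : form_field N) : Prop :=
  forall M : N, [/\ symmetric_bilinear_at h M, nondegenerate_at h M &
                    has_signature_at h p q M].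

Definition metric_class (R : realType) (n : nat) (N : smooth_manifold R n)
  (k : nat) (h : form_field N) : Prop :=
  forall phi, matlas phi ->
    forall i j : 'I_n, Ck k (cimg phi) (metric_coef h phi i j).

Definition metric_matrix (R : realType) (n : nat) (N : smooth_manifold R n)
  (h : form_field N) (phi : chart R n N) (y : 'rV[R]_n) : 'M[R]_n :=
  \matrix_(i, j) metric_coef h phi i j y.

(* christoffel h phi i j k y is Gamma^i_{jk}(y) in the chart phi. *)
Definition christoffel (R : realType) (n : nat) (N : smooth_manifold R n)
  (h : form_field N) (phi : chart R n N) (i j k : 'I_n) (y : 'rV[R]_n) : R :=
  2^-1 * \sum_(l < n) invmx (metric_matrix h phi y) i l *
    (pderiv j (metric_coef h phi l k) y + pderiv k (metric_coef h phi j l) y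
     - pderiv l (metric_coef h phi j k) y).

Definition laplacian (R : realType) (m : nat) (f : 'rV[R]_m -> R)
  (x : 'rV[R]_m) : R := \sum_(mu < m) pderiv mu (pderiv mu f) x.

Definition local_coord (R : realType) (m n : nat) (N : smooth_manifold R n)
  (u : 'rV[R]_m -> N) (phi : chart R n N) (i : 'I_n) : 'rV[R]_m -> R :=
  fun x => cmap phi (u x) 0 i.

(* Class C^k of a map from an open subset A of R^m to N. *)
Definition Ck_map (R : realType) (m n : nat) (N : smooth_manifold R n)
  (k : nat) (A : set 'rV[R]_m) (u : 'rV[R]_m -> N) : Prop :=
  {within A, continuous u} /\
  forall phi, matlas phi ->
    Ck k (A `&` u @^-1` cdom phi) (fun x => cmap phi (u x)).

Definition harmonic_map (R : realType) (m n : nat) (N : smooth_manifold R n)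
  (h : form_field N) (A : set 'rV[R]_m) (u : 'rV[R]_m -> N) : Prop :=
  Ck_map 2 A u /\
  forall phi, matlas phi -> forall x, A x -> cdom phi (u x) ->
    forall i : 'I_n,
      laplacian (local_coord u phi i) x
      + \sum_(mu < m) \sum_(j < n) \sum_(k < n)
          christoffel h phi i j k (cmap phi (u x))
          * pderiv mu (local_coord u phi j) x
          * pderiv mu (local_coord u phi k) x = 0.

(* |f|_{0,alpha;B}, as an extended real. *)
Definition holder_norm (R : realType) (m n : nat) (alpha : R)
  (B : set 'rV[R]_m) (f : 'rV[R]_m -> 'rV[R]_n) : \bar R :=
  (ereal_sup [set (enorm (f x))%:E | x in B] +
   ereal_sup [set (enorm (f z.1 - f z.2) / enorm (z.1 - z.2) `^ alpha)%:E
             | z in [set z : 'rV[R]_m * 'rV[R]_m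
                    | [/\ B z.1, B z.2 & z.1 <> z.2]]])%E.

(* Main.v *)
(* In a chart around u a the Christoffel symbols are bounded, so |Lap u| <= C |Du|^2,
   and u has small oscillation near a.  Doubling of variables then gives the
   Hoelder bound by a maximum principle only.  For F (x, y) = |u x - u y|^2 consider
     F (x, y) - A |x - y|^(1/2) - B (|x - x0|^2 + |y - x0|^2)
       + eps (ln |x - a|^2 + ln |y - a|^2)
   on pairs of points near a.  At a positive interior maximum all second
   directional derivatives are nonpositive.  Sum them over the directions (e_k, 0)
   and (0, e_k), with small weight, and (e_k, S e_k), where S is the reflection along
   x - y: the cross terms in F are absorbed by the squares of the gradients, the
   concavity of the square root in the direction x - y, which S doubles, makes the
   A-term strictly positive, and the logarithms contribute a nonnegative amount when
   m >= 2.  For A large this is a contradiction.  The logarithms keep the maximum away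
   from the singularity, and eps -> 0 removes them.  When m = 1 no logarithm is
   needed: one of x, y differs from a, and moving that point alone suffices. *)
Require Import Defs.
From HB Require Import structures.
From mathcomp Require Import all_boot all_order all_algebra.
From mathcomp Require Import all_classical all_reals all_analysis.
From mathcomp Require Import ring lra.
Import Order.TTheory GRing.Theory Num.Theory.
Import numFieldNormedType.Exports.
Local Open Scope classical_set_scope.
Local Open Scope ring_scope.

(** * Second-order jets of functions of one variable *)

(** The first derivative has to exist near 0, the second only at 0. The pair of numbers propagates
    through sums and compositions, so second derivatives are computed by calculus rules instead of
    difference quotients. *)
Definition second_order_jet {R : realType} (f : R -> R) (p q : R) : Prop :=
  exists g : R -> R, [/\ \forall t \near (0 : R), is_derive (t : R) 1 f (g t),
    g 0 = p & is_derive (0 : R) 1 g q].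

Section jets.
Context {R : realType}.
Implicit Types f g : R -> R.

Lemma jet_cst (c : R) : second_order_jet (fun _ => c) 0 0.
Proof.
exists (fun _ => 0); split => //.
  by near=> t; exact: (is_derive_cst c (t : R) (1 : R)).
exact: (is_derive_cst (0 : R) (0 : R) (1 : R)).
Unshelve. all: by end_near. Qed.

Lemma jetD f g p q p' q' : second_order_jet f p q -> second_order_jet g p' q' ->
  second_order_jet (fun t => f t + g t) (p + p') (q + q').
Proof.
move=> [df [fN <- fd]] [dg [gN <- gd]]; exists (fun t => df t + dg t); split => //.
- by apply: filterS2 fN gN => t ? ?; exact: is_deriveD.
- exact: is_deriveD.
Qed.

Lemma jetZ (c : R) f p q : second_order_jet f p q ->
  second_order_jet (fun t => c * f t) (c * p) (c * q).
Proof.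
move=> [df [fN <- fd]]; exists (fun t => c * df t); split => //.
- by apply: filterS fN => t ?; exact: is_deriveZ.
- exact: is_deriveZ.
Qed.

Lemma jet_sum (n : nat) (f : 'I_n -> R -> R) (p q : 'I_n -> R) :
  (forall i, second_order_jet (f i) (p i) (q i)) ->
  second_order_jet (fun t => \sum_i f i t) (\sum_i p i) (\sum_i q i).
Proof.
elim: n f p q => [|n IH] f p q H.
  rewrite !big_ord0; under eq_fun do rewrite big_ord0; exact: jet_cst.
rewrite !big_ord_recl; under eq_fun do rewrite big_ord_recl.
by apply: jetD => //; exact: IH.
Qed.

Lemma jet_comp (h dh : R -> R) d2h f p q :
  second_order_jet f p q ->
  (\forall s \near f 0, is_derive (s : R) 1 h (dh s)) ->
  is_derive (f 0) 1 dh d2h ->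
  second_order_jet (fun t => h (f t)) (dh (f 0) * p)
    (d2h * p ^+ 2 + dh (f 0) * q).
Proof.
move=> [df [fN <- fd]] hN hd.
have f0 : is_derive (0 : R) 1 f (df 0) by exact: nbhs_singleton fN.
have fc : {for 0, continuous f}.
  by apply/differentiable_continuous/derivable1_diffP; case: f0.
exists (fun t => dh (f t) * df t); split => //.
- have hN' : \forall t \near (0 : R), is_derive (f t) 1 h (dh (f t)) := fc _ hN.
  by apply: filterS2 hN' fN => t ? ?; exact: (@is_derive1_comp _ h f t).
- have -> : d2h * df 0 ^+ 2 + dh (f 0) * q =
     dh (f 0) *: q + df 0 *: (d2h * df 0) by rewrite /GRing.scale /=; ring.
  exact: (@is_deriveM _ _ (dh \o f) df).
Qed.

Lemma jet_sqr f p q : second_order_jet f p q ->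
  second_order_jet (fun t => f t ^+ 2) (2 * f 0 * p) (2 * p ^+ 2 + 2 * f 0 * q).
Proof.
move=> H; apply: (@jet_comp (fun x => x ^+ 2) (fun x => 2 * x) 2 f p q H).
- near=> s.
  have -> : (fun x : R => x ^+ 2) = (id : R -> R) ^+ 2 by apply/funext.
  by apply: is_derive_eq; rewrite /GRing.scale /= expr1 mulr1.
- have -> : (fun x : R => 2 * x) = 2 *: (id : R -> R) by apply/funext.
  by apply: is_derive_eq; rewrite /GRing.scale /= mulr1.
Unshelve. all: by end_near. Qed.

Lemma jet_affine (c d : R) : second_order_jet (fun t => c + t * d) d 0.
Proof.
have jid : second_order_jet (fun t : R => t) 1 0.
  exists (fun _ => 1); split => //; last exact: (is_derive_cst (1 : R) (0 : R) (1 : R)).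
  near=> t.
  exact: (is_derive_id (t : R) (1 : R)).
have := jetD _ _ _ _ _ _ (jet_cst c) (jetZ d _ _ _ jid).
rewrite mulr1 mulr0 !add0r.
by under eq_fun do rewrite mulrC.
Unshelve. all: by end_near. Qed.

(** If [q] were positive, the derivative, which vanishes at an interior maximum, would be positive
    just to the right of 0, and the mean value theorem would produce a value above [f 0]. *)
Lemma jet_max f p q : second_order_jet f p q ->
  (\forall t \near (0 : R), f t <= f 0) -> q <= 0.
Proof.
move=> [df [fN _ fd]] mx; rewrite leNgt; apply/negP => q0.
have df0 : df 0 = 0.
  have [e /= e0 He] := filterI fN mx.
  have H t : t \in `](- e), e[%R -> is_derive t 1 f (df t) /\ f t <= f 0.
    by rewrite in_itv /= => ?; apply: He; rewrite /= sub0r normrN ltr_norml.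
  have ee : - e <= e by lra.
  have := @derive1_at_max R f (- e) e 0 ee.
  have h0 : (0 : R) \in `](- e), e[%R by rewrite in_itv /=; lra.
  have [d _] := H _ h0.
  case=> // [t /H [[]]//|t /H []//|_ E].
  by rewrite derive_val in E.
have dpos : \forall t \near (0 : R), 0 < t -> 0 < df t.
  (* The slope [k] of [df] is continuous at 0 with [k 0 = q > 0], and [df t = k t * t] because
     [df 0 = 0]. *)
  have [k [kE kc k0]] := (is_derive1_caratheodory df (0 : R) q).1 fd.
  have kp : \forall t \near (0 : R), 0 < k t.
    by apply: (kc (fun x => 0 < x)); rewrite k0; exact: lt_nbhsr.
  near=> t => t0.
  have := kE t; rewrite df0 !subr0 => ->.
  by rewrite pmulr_lgt0//; near: t.
have [e /= e0 He] := filterI fN (filterI mx dpos).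
have H t : 0 <= t < e -> [/\ is_derive t 1 f (df t), f t <= f 0 & 0 < t -> 0 < df t].
  move=> te; have tb : ball_ Num.norm 0 e t.
    by rewrite /= sub0r normrN ger0_norm; lra.
  by have [? []] := He t tb.
have e2 : 0 < e / 2 by lra.
have [t||c] := @MVT R f df 0 (e / 2) e2.
- by rewrite in_itv /= => ?; have [|] := H t; first lra.
- apply: derivable_within_continuous => t; rewrite in_itv /= => ?.
  by have [|[]] := H t; first lra.
- rewrite in_itv /= => cc E.
  have [|_ _ h1] := H c; first lra.
  have [|_ h2 _] := H (e / 2); first lra.
  have h3 : 0 < df c by apply: h1; lra.
  have : 0 < df c * (e / 2 - 0) by apply: mulr_gt0; lra.
  lra.
Unshelve. all: by end_near. Qed.

Lemma jet_ln f p q : second_order_jet f p q -> 0 < f 0 ->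
  second_order_jet (fun t => ln (f t)) (p / f 0) (q / f 0 - (p / f 0) ^+ 2).
Proof.
move=> H f0.
have -> : p / f 0 = (f 0)^-1 * p by rewrite mulrC.
have -> : q / f 0 - ((f 0)^-1 * p) ^+ 2 =
   - (f 0) ^- 2 * p ^+ 2 + (f 0)^-1 * q by rewrite exprMn exprVn; ring.
apply: (@jet_comp _ (fun s => s^-1)) H _ _.
- near=> s; apply: is_derive1_ln; near: s; exact: lt_nbhsr.
- have -> : - (f 0) ^- 2 = - (f 0) ^- 2 *: 1 by rewrite /GRing.scale /= mulr1.
  by apply: (@is_deriveV _ id); rewrite ?gt_eqF.
Unshelve. all: by end_near. Qed.

(** Applied to a squared Euclidean length this is the modulus |x - y|^(1/2); the inner function then
    stays polynomial. *)
Definition root4 (s : R) : R := Num.sqrt (Num.sqrt s).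

Lemma is_derive_root4 (s : R) : 0 < s -> is_derive s 1 root4 (root4 s / (4 * s)).
Proof.
move=> s0; have q0 : 0 < Num.sqrt s by rewrite sqrtr_gt0.
have r0 : 0 < root4 s by rewrite sqrtr_gt0.
have -> : root4 s / (4 * s) = (2 * root4 s)^-1 * (2 * Num.sqrt s)^-1.
  have e1 : s = Num.sqrt s ^+ 2 by rewrite sqr_sqrtr// ltW.
  have e2 : Num.sqrt s = root4 s ^+ 2 by rewrite sqr_sqrtr// ltW.
  by rewrite [X in _ / (4 * X)]e1 e2; field; rewrite gt_eqF.
by apply: (@is_derive1_comp _ Num.sqrt Num.sqrt); exact: is_derive1_sqrt.
Qed.

(** The derivatives of s^(1/4) are s^(1/4)/(4s) and -3 s^(1/4)/(16 s^2). The first is factored out,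
    so that concavity appears as the negative term in [p ^+ 2]. *)
Lemma jet_root4 f p q : second_order_jet f p q -> 0 < f 0 ->
  second_order_jet (fun t => root4 (f t)) (root4 (f 0) / (4 * f 0) * p)
    (root4 (f 0) / (4 * f 0) * (q - 3 / (4 * f 0) * p ^+ 2)).
Proof.
move=> H f0.
have -> : root4 (f 0) / (4 * f 0) * (q - 3 / (4 * f 0) * p ^+ 2) =
  (- 3 * root4 (f 0) / (16 * f 0 ^+ 2)) * p ^+ 2 + root4 (f 0) / (4 * f 0) * q.
  by field; lra.
apply: (@jet_comp _ (fun s => root4 s / (4 * s))) H _ _.
- near=> s; apply: is_derive_root4; near: s; exact: lt_nbhsr.
- have f0' : 4 * f 0 != 0 by lra.
  have d1 := is_derive_root4 _ f0.
  have d2 : is_derive (f 0) 1 (fun s => 4 * s) 4.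
    have -> : (fun x : R => 4 * x) = 4 *: (id : R -> R) by apply/funext.
    by apply: is_derive_eq; rewrite /GRing.scale /= mulr1.
  have d3 := @is_deriveV _ (fun s => 4 * s) (f 0) 4 1 f0' d2.
  have := @is_deriveM _ _ root4 _ _ _ _ _ d1 d3.
  move=> d4; apply: (is_derive_eq d4); rewrite /GRing.scale /=; field; lra.
Unshelve. all: by end_near. Qed.

End jets.
(** * Quadratic forms summed over orthonormal frames *)

Section quadratic_forms.
Context {R : realType} {m : nat}.
Implicit Types (u v w x z : 'rV[R]_m) (H O : 'M[R]_m).

Definition sqn v : R := \sum_i v 0 i ^+ 2.
Definition dot u v : R := \sum_i u 0 i * v 0 i.
Definition qform H v : R := \sum_i \sum_j v 0 i * v 0 j * H i j.

Lemma sqn_ge0 v : 0 <= sqn v.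
Proof. by apply: sumr_ge0 => i _; exact: sqr_ge0. Qed.

Lemma sqn_eq0 v : (sqn v == 0) = (v == 0).
Proof.
apply/idP/eqP => [|->]; last first.
  by rewrite /sqn big1// => i _; rewrite mxE expr0n.
rewrite psumr_eq0; last by move=> i _; exact: sqr_ge0.
move=> /allP H; apply/rowP => i; rewrite mxE; apply/eqP.
by rewrite -sqrf_eq0; apply: H; rewrite mem_index_enum.
Qed.

Lemma sqn_gt0 v : (0 < sqn v) = (v != 0).
Proof. by rewrite lt0r sqn_ge0 andbT sqn_eq0. Qed.

Lemma sqn0 : sqn 0 = 0.
Proof. by apply/eqP; rewrite sqn_eq0. Qed.

Lemma dotvv v : dot v v = sqn v.
Proof. by []. Qed.

Lemma dot0r u : dot u 0 = 0.
Proof. by rewrite /dot big1// => i _; rewrite mxE mulr0. Qed.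

Lemma qform0 H : qform H 0 = 0.
Proof. by rewrite /qform big1// => i _; rewrite big1// => j _; rewrite !mxE !mul0r. Qed.

Lemma dotZr (c : R) u v : dot u (c *: v) = c * dot u v.
Proof. by rewrite /dot mulr_sumr; apply: eq_bigr => i _; rewrite mxE; ring. Qed.

Lemma sqnZ (c : R) v : sqn (c *: v) = c ^+ 2 * sqn v.
Proof. by rewrite /sqn mulr_sumr; apply: eq_bigr => i _; rewrite mxE exprMn. Qed.

Lemma sqnN v : sqn (- v) = sqn v.
Proof. by apply: eq_bigr => i _; rewrite mxE sqrrN. Qed.

Lemma sqnBC u v : sqn (u - v) = sqn (v - u).
Proof. by rewrite -sqnN opprB. Qed.

Lemma sqnD_le u v : sqn (u + v) <= 2 * sqn u + 2 * sqn v.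
Proof.
rewrite /sqn !mulr_sumr -big_split/=; apply: ler_sum => i _; rewrite mxE.
rewrite -subr_ge0; set a := u 0 i; set b := v 0 i.
have -> : 2 * a ^+ 2 + 2 * b ^+ 2 - (a + b) ^+ 2 = (a - b) ^+ 2 by ring.
exact: sqr_ge0.
Qed.

Lemma sqn_sub_le u v w : sqn (u - w) <= 2 * sqn (u - v) + 2 * sqn (v - w).
Proof. by rewrite -(subrKA v) sqnD_le. Qed.

(** The trace is the same in every orthonormal frame, here the rows of [O]: summing over [k] first
    produces the entries of [O^T *m O], which is the identity. *)
Lemma sum_qform_orthonormal H O : O *m O^T = 1%:M ->
  \sum_k qform H (row k O) = \tr H.
Proof.
move=> /mulmx1C OO; rewrite /qform exchange_big /= /mxtrace.
apply: eq_bigr => i _; rewrite exchange_big /=.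
transitivity (\sum_j (O^T *m O) i j * H i j).
  apply: eq_bigr => j _; rewrite mxE mulr_suml; apply: eq_bigr => k _.
  by rewrite !mxE.
rewrite OO (bigD1 i)//= mxE eqxx mul1r big1 ?addr0// => j /negPf ji.
by rewrite mxE eq_sym ji mul0r.
Qed.

Lemma sum_sqn_orthonormal O : O *m O^T = 1%:M -> \sum_k sqn (row k O) = m%:R.
Proof.
move=> OO; rewrite -(@mxtrace1 R m) -(sum_qform_orthonormal 1%:M O OO).
apply: eq_bigr => k _; apply: eq_bigr => i _.
rewrite (bigD1 i)//= !mxE eqxx mulr1 big1 ?addr0// => j /negPf ji.
by rewrite !mxE eq_sym ji mulr0.
Qed.

(** Parseval's identity, as the trace of the rank one form [z^T *m z]. *)
Lemma sum_dot_orthonormal z O : O *m O^T = 1%:M ->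
  \sum_k dot z (row k O) ^+ 2 = sqn z.
Proof.
move=> OO; transitivity (\sum_k qform (z^T *m z) (row k O)).
  apply: eq_bigr => k _; rewrite expr2 {1}/dot mulr_suml; apply: eq_bigr => i _.
  rewrite /dot mulr_sumr; apply: eq_bigr => j _.
  by rewrite !mxE big_ord1 !mxE; ring.
rewrite sum_qform_orthonormal// /mxtrace /sqn; apply: eq_bigr => i _.
by rewrite !mxE big_ord1 !mxE expr2.
Qed.

(** The Householder reflection, sending [z] to [- z] and fixing the orthogonal complement. It is
    symmetric, so its rows are the images of the standard basis vectors. *)
Definition reflection z : 'M[R]_m := 1%:M - (2 / sqn z) *: (z^T *m z).

Lemma row_reflection z k :
  row k (reflection z) = row k 1%:M - (2 / sqn z * z 0 k) *: z.
Proof. by apply/rowP => j; rewrite !mxE big_ord1 !mxE mulrA. Qed.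

Lemma reflection_orthonormal z : z != 0 ->
  reflection z *m (reflection z)^T = 1%:M.
Proof.
move=> z0; have s0 : sqn z != 0 by rewrite sqn_eq0.
have -> : (reflection z)^T = reflection z.
  by apply/matrixP => i j; rewrite !mxE !big_ord1 !mxE eq_sym (mulrC (z 0 i)).
rewrite /reflection; set c := 2 / sqn z.
rewrite mulmxBl mul1mx -scalemxAl !mulmxBr mulmx1 -scalemxAr.
have -> : z^T *m z *m (z^T *m z) = sqn z *: (z^T *m z).
  rewrite mulmxA -(mulmxA z^T z z^T).
  have -> : z *m z^T = (sqn z)%:M.
    apply/matrixP => i j; rewrite !mxE !ord1 eqxx mulr1n.
    by apply: eq_bigr => k _; rewrite !mxE expr2.
  by rewrite mul_mx_scalar -scalemxAl.
set M := z^T *m z; rewrite ?scalerBr ?scalerA.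
have -> : c * c * sqn z = c + c by rewrite /c; field.
by rewrite scalerDl opprB addrK subrK.
Qed.

End quadratic_forms.

(** * Jets of squared lengths along lines *)

Section jets_along_lines.
Context {R : realType}.

Lemma jet_sqn {n : nat} (f : R -> 'rV[R]_n) (p q : 'I_n -> R) :
  (forall i, second_order_jet (fun t => f t 0 i) (p i) (q i)) ->
  second_order_jet (fun t => sqn (f t)) (\sum_i 2 * f 0 0 i * p i)
    (\sum_i (2 * p i ^+ 2 + 2 * f 0 0 i * q i)).
Proof. by move=> H; apply: jet_sum => i; apply: jet_sqr. Qed.

Lemma jet_sqn_line {m : nat} (z d : 'rV[R]_m) :
  second_order_jet (fun t => sqn (z + t *: d)) (2 * dot z d) (2 * sqn d).
Proof.
have := @jet_sqn m (fun t => z + t *: d) (fun i => d 0 i) (fun _ => 0) _.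
have -> : \sum_i 2 * (z + 0 *: d) 0 i * d 0 i = 2 * dot z d.
  by rewrite /dot mulr_sumr; apply: eq_bigr => i _; rewrite !mxE; ring.
have -> : \sum_i (2 * d 0 i ^+ 2 + 2 * (z + 0 *: d) 0 i * 0) = 2 * sqn d.
  by rewrite /sqn mulr_sumr; apply: eq_bigr => i _; ring.
apply=> i; under eq_fun do rewrite !mxE; exact: jet_affine.
Qed.

End jets_along_lines.
(** * A direction of positive second derivative *)

Section positive_direction.
Context {R : realType} {m n : nat}.
Variables (Jx Jy : 'I_n -> 'rV[R]_m) (Hx Hy : 'I_n -> 'M[R]_m) (d : 'I_n -> R).
Variables (C : R).

(** The second derivative at t = 0 of |u(x + tv) - u(y + tw)|^2, where [Jx i], [Jy i] are the
    gradients and [Hx i], [Hy i] the Hessians of the components, and [d] is u(x) - u(y). *)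
Definition second_dist (v w : 'rV[R]_m) : R :=
  \sum_i (2 * (dot (Jx i) v - dot (Jy i) w) ^+ 2 +
          2 * d i * (qform (Hx i) v - qform (Hy i) w)).

(** The second derivative at t = 0 of |z + tv|^(1/2), with [rho] standing for |z|^(1/2). *)
Definition second_root4 (rho : R) (z v : 'rV[R]_m) : R :=
  rho / (4 * sqn z) * (2 * sqn v - 3 / (4 * sqn z) * (2 * dot z v) ^+ 2).

(** The second derivative at t = 0 of ln |X + tv|^2. *)
Definition second_ln (X v : 'rV[R]_m) : R :=
  2 * sqn v / sqn X - (2 * dot X v / sqn X) ^+ 2.

Lemma orthonormal1 : (1%:M : 'M[R]_m) *m (1%:M)^T = 1%:M.
Proof. by rewrite trmx1 mulmx1. Qed.

(** The sum is the Laplacian of ln |X|^2, which equals 2(m - 2)/|X|^2. *)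
Lemma sum_second_ln (X : 'rV[R]_m) (O : 'M[R]_m) : (2 <= m)%N -> X != 0 ->
  O *m O^T = 1%:M -> 0 <= \sum_k second_ln X (row k O).
Proof.
move=> m2 X0 OO; have s0 : 0 < sqn X by rewrite sqn_gt0.
have -> : \sum_k second_ln X (row k O) =
   2 / sqn X * \sum_k sqn (row k O) - 4 / sqn X ^+ 2 * \sum_k dot X (row k O) ^+ 2.
  rewrite !mulr_sumr -sumrB; apply: eq_bigr => k _; rewrite /second_ln.
  by field; rewrite gt_eqF.
rewrite sum_sqn_orthonormal// sum_dot_orthonormal//.
have -> : 2 / sqn X * m%:R - 4 / sqn X ^+ 2 * sqn X = 2 * (m%:R - 2) / sqn X.
  by field; rewrite gt_eqF.
by apply: divr_ge0; [rewrite mulr_ge0// subr_ge0 ler_nat|exact: ltW].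
Qed.

(** The Laplacian of |z|^(1/2). It is positive for m >= 2, so that moving one point alone gives the
    A-term the wrong sign; for m = 1 it is negative. *)
Lemma sum_second_root4 (rho : R) (z : 'rV[R]_m) : z != 0 ->
  \sum_k second_root4 rho z (row k 1%:M) = rho / (4 * sqn z) * (2 * m%:R - 3).
Proof.
move=> z0; have s0 : sqn z != 0 by rewrite sqn_eq0.
set c := rho / (4 * sqn z).
have -> : \sum_k second_root4 rho z (row k 1%:M) = c * (2 * \sum_k sqn (row k (1%:M : 'M[R]_m)) -
    3 / sqn z * \sum_k dot z (row k 1%:M) ^+ 2).
  rewrite !mulr_sumr -sumrB mulr_sumr; apply: eq_bigr => k _.
  by rewrite /second_root4 -/c; field.
rewrite sum_sqn_orthonormal ?orthonormal1// sum_dot_orthonormal ?orthonormal1//.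
by field.
Qed.

Lemma second_root4N (rho : R) (z v : 'rV[R]_m) :
  second_root4 rho z (- v) = second_root4 rho z v.
Proof.
by rewrite /second_root4 sqnN -(scaleN1r v) dotZr mulN1r mulrN sqrrN.
Qed.

(** The vector e_k - S e_k is 2 z_k z/|z|^2, so only the negative radial second derivative is seen,
    and the squared lengths of these vectors add up to 4. *)
Lemma sum_second_root4_reflection (rho : R) (z : 'rV[R]_m) : z != 0 ->
  \sum_k second_root4 rho z (row k 1%:M - row k (reflection z)) =
  rho / (4 * sqn z) * - 4.
Proof.
move=> z0; have s0 : sqn z != 0 by rewrite sqn_eq0.
set c := rho / (4 * sqn z).
have -> : \sum_k second_root4 rho z (row k 1%:M - row k (reflection z)) =
   c * (- 4 / sqn z * \sum_k z 0 k ^+ 2).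
  rewrite !mulr_sumr; apply: eq_bigr => k _.
  rewrite row_reflection opprB addrC subrK /second_root4 sqnZ dotZr dotvv.
  by rewrite -/c; field.
by rewrite -/(sqn z); field.
Qed.

Lemma sum_second_dist_l :
  \sum_k second_dist (row k 1%:M) 0 =
  2 * \sum_i sqn (Jx i) + 2 * \sum_i d i * \tr (Hx i).
Proof.
rewrite exchange_big !mulr_sumr -big_split; apply: eq_bigr => i _ /=.
rewrite big_split/= -(sum_dot_orthonormal (Jx i) _ orthonormal1).
rewrite -(sum_qform_orthonormal (Hx i) _ orthonormal1) !mulr_sumr.
by congr (_ + _); apply: eq_bigr => k _; rewrite ?dot0r ?qform0 !subr0// mulrA.
Qed.

Lemma sum_second_dist_r :
  \sum_k second_dist 0 (row k 1%:M) =
  2 * \sum_i sqn (Jy i) - 2 * \sum_i d i * \tr (Hy i).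
Proof.
rewrite exchange_big !mulr_sumr -sumrB; apply: eq_bigr => i _ /=.
rewrite big_split/= -(sum_dot_orthonormal (Jy i) _ orthonormal1).
rewrite -(sum_qform_orthonormal (Hy i) _ orthonormal1) !mulr_sumr -sumrN.
by congr (_ + _); apply: eq_bigr => k _; rewrite ?dot0r ?qform0; ring.
Qed.

(** The squares, which contain the mixed products of gradients at the two points, are dropped as
    nonnegative; trace invariance evaluates the Hessian terms in either frame. *)
Lemma sum_second_dist_ge (O : 'M[R]_m) : O *m O^T = 1%:M ->
  2 * \sum_i d i * \tr (Hx i) - 2 * \sum_i d i * \tr (Hy i) <=
  \sum_k second_dist (row k 1%:M) (row k O).
Proof.
move=> OO; rewrite [leRHS]exchange_big !mulr_sumr -sumrB; apply: ler_sum => i _ /=.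
rewrite big_split/= -(sum_qform_orthonormal (Hx i) _ orthonormal1).
rewrite -(sum_qform_orthonormal (Hy i) _ OO) -[leLHS]add0r; apply: lerD.
  by apply: sumr_ge0 => k _; rewrite mulr_ge0// sqr_ge0.
by rewrite -mulr_sumr sumrB le_eqVlt; apply/orP; left; apply/eqP; ring.
Qed.

(** Small oscillation enters here: traces of quadratic growth, multiplied by a small [d], are
    absorbed by the squared gradients. *)
Lemma weighted_trace_le (J : 'I_n -> 'rV[R]_m) (H : 'I_n -> 'M[R]_m) (k : R) :
  (forall i, `|\tr (H i)| <= C * \sum_j sqn (J j)) -> 0 <= k ->
  k * (C * \sum_i `|d i|) <= 1 ->
  k * `|\sum_i d i * \tr (H i)| <= \sum_j sqn (J j).
Proof.
move=> hH k0 kC; set E := \sum_j sqn (J j).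
have E0 : 0 <= E by apply: sumr_ge0 => j _; exact: sqn_ge0.
apply: (@le_trans _ _ (k * (C * \sum_i `|d i|) * E)); last exact: ler_piMl.
rewrite -!mulrA ler_wpM2l//; apply: le_trans (ler_norm_sum _ _ _) _.
rewrite mulr_suml mulr_sumr; apply: ler_sum => i _.
by rewrite normrM mulrCA ler_wpM2l.
Qed.

Hypothesis hHx : forall i, `|\tr (Hx i)| <= C * \sum_j sqn (Jx j).
Hypothesis hHy : forall i, `|\tr (Hy i)| <= C * \sum_j sqn (Jy j).
Hypothesis hd : 2 * m%:R * (C * \sum_i `|d i|) <= 1.

(** Otherwise the sums over the three families, weighted 1, 1 and 2m - 1, would be nonpositive. The
    trace terms get total coefficient 4m and are absorbed by twice the squared gradients, thanks to
    [hd]. The A-term gets 4(2m - 1) - 2(2m - 3) = 4m + 2 times A rho/(4|z|^2), and the penalty gets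
    -8 m^2 B. The assumption on [A] says that A rho/(4|z|^2) > 2mB, so the total is positive. *)
Lemma exists_positive_direction (z X Y : 'rV[R]_m) (A B eps rho : R) :
  (2 <= m)%N -> z != 0 -> X != 0 -> Y != 0 -> 0 <= eps -> 0 <= B ->
  8 * m%:R * B * sqn z < A * rho ->
  exists v w, 0 < second_dist v w - A * second_root4 rho z (v - w)
    - B * (2 * sqn v + 2 * sqn w) + eps * (second_ln X v + second_ln Y w).
Proof.
move=> m2 z0 X0 Y0 eps0 B0 hA; apply: contrapT => /forallNP nex.
pose Q v w := second_dist v w - A * second_root4 rho z (v - w)
    - B * (2 * sqn v + 2 * sqn w) + eps * (second_ln X v + second_ln Y w).
have Qle v w : Q v w <= 0.
  by rewrite leNgt; apply/negP => ?; apply: (nex v); exists w.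
have m0 : 0 < (m%:R : R) by rewrite ltr0n ltnW.
have m20 : 0 <= 2 * (m%:R : R) by rewrite mulr_ge0// ltW.
have m21 : 0 <= 2 * (m%:R : R) - 1.
  by rewrite -natrM subr_ge0 ler1n muln_gt0; exact: ltnW.
pose S := reflection z; have SO : S *m S^T = 1%:M by exact: reflection_orthonormal.
have sumQ (f g : 'I_m -> 'rV[R]_m) : \sum_k Q (f k) (g k) =
    \sum_k second_dist (f k) (g k) - A * \sum_k second_root4 rho z (f k - g k)
    - B * (2 * \sum_k sqn (f k) + 2 * \sum_k sqn (g k))
    + eps * (\sum_k second_ln X (f k) + \sum_k second_ln Y (g k)).
  rewrite /Q; move: second_dist (second_root4 rho z) (second_ln X) (second_ln Y).
  move=> D T LX LY; rewrite big_split/= !sumrB -!mulr_sumr.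
  by rewrite !big_split/= -!mulr_sumr.
have s0 : 0 < sqn z by rewrite sqn_gt0.
have ln0 Z : second_ln Z 0 = 0 by rewrite /second_ln sqn0 dot0r !mulr0 !mul0r expr0n subr0.
have sum0 (f : 'I_m -> R) : (forall k, f k = 0) -> \sum_k f k = 0 by move=> h; rewrite big1.
have O1 := orthonormal1.
have T1 : \sum_k second_root4 rho z (row k 1%:M - 0) =
    rho / (4 * sqn z) * (2 * m%:R - 3).
  by under eq_bigr do rewrite subr0; exact: sum_second_root4.
have T2 : \sum_k second_root4 rho z (0 - row k 1%:M) =
    rho / (4 * sqn z) * (2 * m%:R - 3).
  by under eq_bigr do rewrite sub0r second_root4N; exact: sum_second_root4.
have Q1 : \sum_k Q (row k 1%:M) 0 <= 0 by apply: sumr_le0.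
have Q2 : \sum_k Q 0 (row k 1%:M) <= 0 by apply: sumr_le0.
have Q3 : \sum_k Q (row k 1%:M) (row k S) <= 0 by apply: sumr_le0.
rewrite sumQ sum_second_dist_l sum_sqn_orthonormal// in Q1.
rewrite (sum0 (fun=> sqn 0)) ?(sum0 (fun=> second_ln Y 0)) ?sqn0// in Q1.
rewrite T1 in Q1.
rewrite sumQ sum_second_dist_r sum_sqn_orthonormal// in Q2.
rewrite (sum0 (fun=> sqn 0)) ?(sum0 (fun=> second_ln X 0)) ?sqn0// in Q2.
rewrite T2 in Q2.
rewrite sumQ !sum_sqn_orthonormal// sum_second_root4_reflection// in Q3.
have D3 := sum_second_dist_ge S SO.
have L1 := sum_second_ln X _ m2 X0 O1.
have L2 := sum_second_ln Y _ m2 Y0 O1.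
have L3 := sum_second_ln Y _ m2 Y0 SO.
have TX := weighted_trace_le Jx Hx _ hHx m20 hd.
have TY := weighted_trace_le Jy Hy _ hHy m20 hd.
move: Q1 Q2 Q3 D3 L1 L2 L3 TX TY.
set EX := \sum_i sqn (Jx i); set EY := \sum_i sqn (Jy i).
set tx := \sum_i d i * \tr (Hx i); set ty := \sum_i d i * \tr (Hy i).
set l1 := \sum_k second_ln X (row k 1%:M); set l2 := \sum_k second_ln Y (row k 1%:M).
set l3 := \sum_k second_ln Y (row k S); set d3 := \sum_k second_dist _ _.
set M : R := m%:R; set kk := rho / _ => Q1 Q2 Q3 D3 L1 L2 L3 TX TY.
have k1 : 2 * M * B < A * kk.
  have -> : A * kk = A * rho / (4 * sqn z) by rewrite /kk mulrA.
  rewrite ltr_pdivlMr ?mulr_gt0//.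
  by have -> : 2 * M * B * (4 * sqn z) = 8 * M * B * sqn z by ring.
have e1 : 0 <= eps * l1 by exact: mulr_ge0.
have e2 : 0 <= eps * l2 by exact: mulr_ge0.
have tx1 : - (2 * M * `|tx|) <= 2 * M * tx.
  by rewrite -mulrN ler_wpM2l// lerNnormlW.
have ty1 : 2 * M * ty <= 2 * M * `|ty| by rewrite ler_wpM2l// ler_norm.
have Q3' : (2 * M - 1) * (2 * tx - 2 * ty - A * (kk * - 4) -
   B * (2 * M + 2 * M) + eps * (l1 + l3)) <= 0.
  by apply: mulr_ge0_le0 => //; apply: le_trans _ Q3; rewrite !lerD2r.
have h4 : 0 < (A * kk - 2 * M * B) * M by rewrite mulr_gt0// subr_gt0.
have h5 : 0 <= (2 * M - 1) * (eps * (l1 + l3)) by rewrite !mulr_ge0// addr_ge0.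
have h6 : 0 <= M * B by rewrite mulr_ge0// ltW.
(* Q1 and Q2 with weight 1, Q3 with weight 2m - 1. *)
move: Q1 Q2 Q3' D3 TX TY k1 e1 e2 tx1 ty1 h4 h5 h6; clear; lra.
Qed.

(** In dimension one a unit vector is already an orthonormal frame, which is what the conditions on
    [qform] and [dot] express. The second point stays fixed, and the concavity of |z|^(1/2) on a
    half-line beats the penalty. *)
Lemma positive_direction_line (z v : 'rV[R]_m) (A B rho : R) :
  m = 1%N -> sqn v = 1 -> z != 0 -> 8 * m%:R * B * sqn z < A * rho ->
  (forall H : 'M[R]_m, qform H v = \tr H) -> (forall x, dot x v ^+ 2 = sqn x) ->
  0 < second_dist v 0 - A * second_root4 rho z v - B * (2 * sqn v).
Proof.
move=> m1 v1 z0 hA qv dv; have s0 : 0 < sqn z by rewrite sqn_gt0.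
have m1R : (m%:R : R) = 1 by rewrite m1.
rewrite m1R in hA.
have -> : A * second_root4 rho z v = - (A * rho / (4 * sqn z)).
  by rewrite /second_root4 v1 exprMn dv; field; rewrite gt_eqF.
have k1 : 2 * B < A * rho / (4 * sqn z) by rewrite ltr_pdivlMr; lra.
have -> : second_dist v 0 =
    2 * \sum_i sqn (Jx i) + 2 * \sum_i d i * \tr (Hx i).
  rewrite !mulr_sumr -big_split; apply: eq_bigr => i _ /=.
  by rewrite dot0r qform0 !subr0 dv qv mulrA.
have hd1 := hd; rewrite m1R mulr1 in hd1.
have h := weighted_trace_le Jx Hx 2 hHx (ler0n R 2) hd1.
have E0 : 0 <= \sum_i sqn (Jx i) by apply: sumr_ge0 => j _; exact: sqn_ge0.
have := lerNnormlW (lexx `|\sum_i d i * \tr (Hx i)|).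
rewrite v1; lra.
Qed.

End positive_direction.
(** * The doubled function and its maximum *)

Section continuity.
Context {R : realType} {m : nat}.

Lemma sqn_continuous : continuous (@sqn R m).
Proof.
move=> x; apply: differentiable_continuous.
have -> : @sqn R m = \sum_i (fun v : 'rV[R]_m => v 0 i) ^+ 2.
  by apply/funext => v; rewrite fct_sumE; apply: eq_bigr => i _; rewrite exprfctE.
by apply: differentiable_sum => i; apply: differentiableX; exact: differentiable_coord.
Qed.

Lemma root4_continuous : continuous (@root4 R).
Proof.
by move=> x; apply: continuous_comp; exact: sqrt_continuous.
Qed.

Lemma compact_annulus (a : 'rV[R]_m) (e r : R) :
  compact [set x | e <= sqn (x - a) <= r].
Proof.
apply: bounded_closed_compact.
(* If t^2 <= r then |t| <= 1 + r, which bounds each entry of [x - a] without a square root. *)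
- exists (`|a| + (1 + r)); split; first exact: num_real.
  move=> N hN x /= /andP[_ xr]; apply: le_trans (ltW hN).
  rewrite -[x](subrK a) addrC; apply: le_trans (ler_normD _ _) _; rewrite lerD2l.
  have r0 : 0 <= r by apply: le_trans xr; exact: sqn_ge0.
  rewrite [leLHS]/Num.norm /= mx_normrE; apply: bigmax_le; first by lra.
  move=> [i j] _ /=; rewrite ord1.
  have h : (x - a) 0 j ^+ 2 <= r.
    apply: le_trans xr; rewrite /sqn (bigD1 j)//= lerDl.
    by apply: sumr_ge0 => k _; exact: sqr_ge0.
  rewrite -(@ler_pXn2r _ 2) ?nnegrE ?addr_ge0// ?real_normK ?num_real//.
  apply: le_trans h _; nra.
- have -> : [set x | e <= sqn (x - a) <= r] =
     (fun x => sqn (x - a)) @^-1` `[e, r]%classic.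
    by apply/seteqP; split => x /=; rewrite in_itv.
  apply: closed_comp; last exact: interval_closed.
  move=> x _; apply: continuous_comp; last exact: sqn_continuous.
  by apply: continuousB; [exact: cvg_id|exact: cst_continuous].
Qed.

Lemma open_annulus (a : 'rV[R]_m) (e r : R) :
  open [set x | e < sqn (x - a) < r].
Proof.
have -> : [set x | e < sqn (x - a) < r] =
   (fun x => sqn (x - a)) @^-1` `]e, r[%classic.
  by apply/seteqP; split => x /=; rewrite in_itv.
apply: open_comp; last exact: interval_open.
move=> x _; apply: continuous_comp; last exact: sqn_continuous.
by apply: continuousB; [exact: cvg_id|exact: cst_continuous].
Qed.

Lemma near_line (x v : 'rV[R]_m) (A : set 'rV[R]_m) : open A -> A x ->
  \forall t \near (0 : R), A (x + t *: v).
Proof.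
move=> oA Ax; have : {for 0, continuous (fun t : R => x + t *: v)}.
  apply: continuousD; first exact: cst_continuous.
  exact: scalel_continuous.
apply; rewrite /= scale0r addr0; exact: open_nbhs_nbhs.
Qed.

(** A maximum is attained by compactness, so the bound has only to be checked at a maximum point. *)
Lemma compact_max_principle (T : topologicalType) (K : set T) (G : T -> R) (c : R) :
  compact K -> (forall p, K p -> {for p, continuous G}) ->
  (forall p, K p -> (forall q, K q -> G q <= G p) -> G p <= c) ->
  forall p, K p -> G p <= c.
Proof.
move=> cK cG H p Kp.
have [||q /set_mem Kq qmax] := @compact_EVT_max T R G K _ cK.
- by exists p.
- by apply: continuous_in_subspaceT => z /set_mem; exact: cG.
apply: (@le_trans _ _ (G q)); first by apply: qmax; exact/mem_set.
by apply: H => // z Kz; apply: qmax; exact/mem_set.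
Qed.

End continuity.

(** * Second derivative test for the doubled function *)

Section doubling.
Context {R : realType} {m n : nat}.
Variables (u : 'rV[R]_m -> 'rV[R]_n) (x0 : 'rV[R]_m) (A B : R).

(** The doubled function without its logarithms. The centre [x0] of the penalty stays free until it
    is taken equal to the first point. *)
Definition excess (p : 'rV[R]_m * 'rV[R]_m) : R :=
  sqn (u p.1 - u p.2) - A * root4 (sqn (p.1 - p.2))
  - B * (sqn (p.1 - x0) + sqn (p.2 - x0)).

Lemma excess_continuous p : {for p.1, continuous u} -> {for p.2, continuous u} ->
  {for p, continuous excess}.
Proof.
move=> c1 c2.
have f1 : {for p, continuous (fst : 'rV[R]_m * 'rV[R]_m -> _)} by exact: cvg_fst.
have f2 : {for p, continuous (snd : 'rV[R]_m * 'rV[R]_m -> _)} by exact: cvg_snd.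
have u1 : {for p, continuous (u \o fst)} by exact: continuous_comp f1 c1.
have u2 : {for p, continuous (u \o snd)} by exact: continuous_comp f2 c2.
have sq k (f g : 'rV[R]_m * 'rV[R]_m -> 'rV[R]_k) :
    {for p, continuous f} -> {for p, continuous g} ->
    {for p, continuous (fun q => sqn (f q - g q))}.
  move=> cf cg; apply: (@continuous_comp _ _ _ (fun q => f q - g q)).
    exact: continuousB.
  exact: sqn_continuous.
have s0 : {for p, continuous (fun q : 'rV[R]_m * 'rV[R]_m => sqn (u q.1 - u q.2))} := sq _ _ _ u1 u2.
have s1 : {for p, continuous (fun q : 'rV[R]_m * 'rV[R]_m => sqn (q.1 - q.2))} := sq _ _ _ f1 f2.
have s2 : {for p, continuous (fun q : 'rV[R]_m * 'rV[R]_m => sqn (q.1 - x0))}.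
  by apply: (sq _ _ (fun=> x0) f1); exact: cst_continuous.
have s3 : {for p, continuous (fun q : 'rV[R]_m * 'rV[R]_m => sqn (q.2 - x0))}.
  by apply: (sq _ _ (fun=> x0) f2); exact: cst_continuous.
have s4 : {for p, continuous (fun q : 'rV[R]_m * 'rV[R]_m => root4 (sqn (q.1 - q.2)))}.
  exact: continuous_comp s1 (root4_continuous _).
have cst (c : R) : {for p, continuous (fun _ : 'rV[R]_m * 'rV[R]_m => c)}.
  exact: cst_continuous.
have s5 := continuousM (cst A) s4.
have s6 := continuousM (cst B) (continuousD s2 s3).
exact: continuousB (continuousB s0 s5) s6.
Qed.

(** Only a local maximum along the line in direction [(v, w)] is used. [L] serves for the
    logarithmic term when m >= 2 and for 0 when m = 1. *)
Lemma excess_second_test (x y v w : 'rV[R]_m) (Jx Jy : 'I_n -> 'rV[R]_m)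
  (Hx Hy : 'I_n -> 'M[R]_m) (L : R -> R) (pL qL : R) :
  x != y ->
  (forall i, second_order_jet (fun t => u (x + t *: v) 0 i)
     (dot (Jx i) v) (qform (Hx i) v)) ->
  (forall i, second_order_jet (fun t => u (y + t *: w) 0 i)
     (dot (Jy i) w) (qform (Hy i) w)) ->
  second_order_jet L pL qL ->
  (\forall t \near (0 : R),
     excess (x + t *: v, y + t *: w) + L t <= excess (x, y) + L 0) ->
  second_dist Jx Jy Hx Hy (fun i => (u x - u y) 0 i) v w
  - A * second_root4 (root4 (sqn (x - y))) (x - y) (v - w)
  - B * (2 * sqn v + 2 * sqn w) + qL <= 0.
Proof.
move=> xy jx jy jL mx.
have j0 i : second_order_jet (fun t => (u (x + t *: v) - u (y + t *: w)) 0 i)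
    (dot (Jx i) v + -1 * dot (Jy i) w) (qform (Hx i) v + -1 * qform (Hy i) w).
  under eq_fun do rewrite !mxE -mulN1r.
  by apply: jetD => //; exact: jetZ.
have j1 := jet_sqn _ _ _ j0.
have s0 : 0 < sqn (x - y + 0 *: (v - w)).
  by rewrite scale0r addr0 sqn_gt0 subr_eq0.
have j2 := jetZ (- A) _ _ _ (jet_root4 _ _ _ (jet_sqn_line (x - y) (v - w)) s0).
have j3 := jetZ (- B) _ _ _
  (jetD _ _ _ _ _ _ (jet_sqn_line (x - x0) v) (jet_sqn_line (y - x0) w)).
have j := jetD _ _ _ _ _ _ (jetD _ _ _ _ _ _ (jetD _ _ _ _ _ _ j1 j2) j3) jL.
apply: le_trans (jet_max _ _ _ j _).
  rewrite !scale0r !addr0 le_eqVlt; apply/orP; left; apply/eqP.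
  rewrite /second_dist /second_root4 !mulNr; congr (_ - _ - _ + _).
  by apply: eq_bigr => i _; rewrite !mulN1r.
apply: filterS mx => t; rewrite /excess /= !mulNr.
have e (p q r s : 'rV[R]_m) : p + r - (q + s) = p - q + (r - s).
  by rewrite opprD addrACA.
rewrite !scale0r !addr0 e scalerBr !(addrAC _ (t *: _)) //.
Qed.

End doubling.

(** * Elementary inequalities for the fourth root *)

Lemma root4_ge0 {R : realType} (s : R) : 0 <= root4 s.
Proof. exact: sqrtr_ge0. Qed.

Lemma root4_gt0 {R : realType} (s : R) : (0 < root4 s) = (0 < s).
Proof. by rewrite /root4 !sqrtr_gt0. Qed.

Lemma root4K {R : realType} (s : R) : 0 <= s -> root4 s ^+ 4 = s.
Proof. by move=> s0; rewrite (exprM _ 2 2) !sqr_sqrtr// sqrtr_ge0. Qed.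

Lemma le_root4 {R : realType} (s t : R) : s <= t -> root4 s <= root4 t.
Proof. by move=> st; rewrite /root4 !ler_wsqrtr. Qed.

(** Write s = s^(3/4) s^(1/4) and enlarge the first factor: on a bounded set a squared distance is
    controlled by |x - y|^(1/2). *)
Lemma le_mul_root4 {R : realType} (s t : R) : 0 <= s <= t ->
  s <= root4 t ^+ 3 * root4 s.
Proof.
move=> /andP[s0 st]; rewrite -{1}(root4K _ s0) exprSr ler_wpM2r ?root4_ge0//.
by apply: lerXn2r; rewrite ?nnegrE ?root4_ge0//; exact: le_root4.
Qed.

(** * Hoelder estimate at an isolated singularity *)

Section isolated_singularity.
Context {R : realType} {m n : nat}.
Variables (u : 'rV[R]_m -> 'rV[R]_n) (a : 'rV[R]_m) (r C M : R).
Hypothesis r_gt0 : 0 < r.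
Hypothesis u_continuous : forall x, sqn (x - a) <= r -> {for x, continuous u}.
Hypothesis u_osc : forall x y, sqn (x - a) <= r -> sqn (y - a) <= r ->
  sqn (u x - u y) <= M.
Hypothesis u_small : forall x y, sqn (x - a) <= r -> sqn (y - a) <= r ->
  2 * m%:R * (C * \sum_i `|(u x - u y) 0 i|) <= 1.
Hypothesis u_jet : forall x, 0 < sqn (x - a) < r ->
  exists (J : 'I_n -> 'rV[R]_m) (H : 'I_n -> 'M[R]_m),
    (forall v i, second_order_jet (fun t => u (x + t *: v) 0 i)
       (dot (J i) v) (qform (H i) v)) /\
    (forall i, `|\tr (H i)| <= C * \sum_j sqn (J j)).

(** On the sphere |z - a|^2 = r a centre with |x0 - a|^2 <= r/4 satisfies |z - x0|^2 >= r/4, so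
    there the penalty B |z - x0|^2 is at least the oscillation bound [M]. *)
Let B := 4 * M / r.
(** Points of the ball satisfy |x - y|^2 <= 4r, hence 8mB |x - y|^2 <= 8mB (4r)^(3/4) |x - y|^(1/2);
    the final 1 makes [penalty_lt] strict off the diagonal. *)
Let A := 8 * m%:R * B * root4 (4 * r) ^+ 3 + 1.

Lemma osc_ge0 : 0 <= M.
Proof.
have h : sqn (a - a) <= r by rewrite subrr sqn0 ltW.
by apply: le_trans (u_osc a a h h); exact: sqn_ge0.
Qed.

Lemma penalty_ge0 : 0 <= B.
Proof. by rewrite /B divr_ge0 ?mulr_ge0 ?osc_ge0// ltW. Qed.

Lemma modulus_ge0 : 0 <= A.
Proof.
apply: addr_ge0 => //; apply: mulr_ge0; last by rewrite exprn_ge0// root4_ge0.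
by apply: mulr_ge0 => //; exact: penalty_ge0.
Qed.

Lemma sqn_ball_le x y : sqn (x - a) <= r -> sqn (y - a) <= r ->
  sqn (x - y) <= 4 * r.
Proof.
move=> hx hy; have := sqn_sub_le x a y; rewrite (sqnBC a y); lra.
Qed.

Lemma penalty_lt x y : sqn (x - a) <= r -> sqn (y - a) <= r -> x != y ->
  8 * m%:R * B * sqn (x - y) < A * root4 (sqn (x - y)).
Proof.
move=> hx hy xy; have s0 : 0 < sqn (x - y) by rewrite sqn_gt0 subr_eq0.
have r0 : 0 < root4 (sqn (x - y)) by rewrite root4_gt0.
have h := le_mul_root4 (sqn (x - y)) (4 * r).
have k0 : 0 <= 8 * m%:R * B by apply: mulr_ge0; [exact: mulr_ge0|exact: penalty_ge0].
have := ler_wpM2l k0 (h _); rewrite sqn_ge0 sqn_ball_le// => /(_ erefl).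
rewrite /A; lra.
Qed.

Section fixed_center.
Variable x0 : 'rV[R]_m.
Hypothesis x0_near : sqn (x0 - a) <= r / 4.

Lemma penalty_boundary x y z : sqn (x - a) <= r -> sqn (y - a) <= r ->
  sqn (z - a) = r -> sqn (u x - u y) <= B * sqn (z - x0).
Proof.
move=> hx hy hz; apply: le_trans (u_osc x y hx hy) _.
have := sqn_sub_le z x0 a; rewrite hz => h.
have h2 : r / 4 <= sqn (z - x0) by have := x0_near; lra.
have -> : M = B * (r / 4) by rewrite /B; field; rewrite gt_eqF.
by rewrite ler_wpM2l// penalty_ge0.
Qed.

Lemma excess_boundary x y : sqn (x - a) <= r -> sqn (y - a) <= r ->
  sqn (x - a) = r \/ sqn (y - a) = r \/ x = y -> excess u x0 A B (x, y) <= 0.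
Proof.
move=> hx hy bd; rewrite /excess /=.
have A0 : 0 <= A * root4 (sqn (x - y)).
  by apply: mulr_ge0; [exact: modulus_ge0|exact: root4_ge0].
have B1 : 0 <= B * sqn (x - x0) by rewrite mulr_ge0 ?penalty_ge0 ?sqn_ge0.
have B2 : 0 <= B * sqn (y - x0) by rewrite mulr_ge0 ?penalty_ge0 ?sqn_ge0.
rewrite mulrDr; case: bd => [e|[e|e]].
- have := penalty_boundary x y x hx hy e; lra.
- have := penalty_boundary x y y hx hy e; lra.
- have -> : sqn (u x - u y) = 0 by rewrite e subrr sqn0.
  lra.
Qed.

(** The maximum over a compact product of annuli is located. On the outer spheres and on the
    diagonal [excess] is nonpositive, on the inner spheres the logarithm compensates, and elsewhere
    the second derivative test is violated. *)
Lemma excess_ln_le (x y : 'rV[R]_m) (eps : R) : (2 <= m)%N -> 0 < eps ->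
  0 < sqn (x - a) <= r -> 0 < sqn (y - a) <= r ->
  excess u x0 A B (x, y) + eps * (ln (sqn (x - a)) + ln (sqn (y - a))) <=
  eps * (2 * ln r).
Proof.
move=> m2 eps0 /andP[x_gt0 xr] /andP[y_gt0 yr].
(* The first two entries keep the given pair inside the annuli; the third makes eps ln eta <= eps ln
   r - M. *)
pose eta := Num.min (Num.min (sqn (x - a)) (sqn (y - a))) (r * expR (- (M / eps))).
have eta0 : 0 < eta by rewrite /eta !lt_min x_gt0 y_gt0/= mulr_gt0// expR_gt0.
have etax : eta <= sqn (x - a) by rewrite /eta !ge_min lexx.
have etay : eta <= sqn (y - a) by rewrite /eta !ge_min lexx orbT.
have etaM : eps * ln eta <= eps * ln r - M.
  have : ln eta <= ln r - M / eps.
    rewrite -(expRK (- (M / eps))) -lnM ?posrE ?expR_gt0// ler_ln ?posrE//.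
      by rewrite /eta ge_min lexx orbT.
    by rewrite mulr_gt0// expR_gt0.
  rewrite -(ler_pM2l eps0) mulrBr => h; apply: le_trans h _.
  by rewrite mulrCA divff ?mulr1// gt_eqF.
pose K := [set p : 'rV[R]_m * 'rV[R]_m |
  eta <= sqn (p.1 - a) <= r /\ eta <= sqn (p.2 - a) <= r].
pose G p := excess u x0 A B p + eps * (ln (sqn (p.1 - a)) + ln (sqn (p.2 - a))).
have lnr p : eta <= sqn (p - a) <= r -> eps * ln (sqn (p - a)) <= eps * ln r.
  by move=> /andP[h1 h2]; rewrite ler_pM2l// ler_ln ?posrE//; exact: lt_le_trans h1.
suff H : forall p, K p -> G p <= eps * (2 * ln r).
  by apply: (H (x, y)); split => /=; apply/andP.
apply: compact_max_principle.
- have -> : K = [set x | eta <= sqn (x - a) <= r] `*` [set x | eta <= sqn (x - a) <= r].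
    by apply/seteqP; split.
  by apply: compact_setX; exact: compact_annulus.
- move=> [p q] [/= /andP[p1 p2] /andP[q1 q2]].
  have p0 : 0 < sqn (p - a) by exact: lt_le_trans p1.
  have q0 : 0 < sqn (q - a) by exact: lt_le_trans q1.
  apply: continuousD; first by apply: excess_continuous; exact: u_continuous.
  have f1 : {for (p, q), continuous (fst : 'rV[R]_m * 'rV[R]_m -> _)} by exact: cvg_fst.
  have f2 : {for (p, q), continuous (snd : 'rV[R]_m * 'rV[R]_m -> _)} by exact: cvg_snd.
  have lnc (f : 'rV[R]_m * 'rV[R]_m -> 'rV[R]_m) : {for (p, q), continuous f} ->
      0 < sqn (f (p, q) - a) -> {for (p, q), continuous (fun z => ln (sqn (f z - a)))}.
    move=> cf f0; apply: (@continuous_comp _ _ _ (fun z => sqn (f z - a)) (@ln R)).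
      apply: (@continuous_comp _ _ _ (fun z => f z - a)); last exact: sqn_continuous.
      by apply: continuousB => //; exact: cst_continuous.
    exact: continuous_ln.
  apply: continuousM; first exact: cst_continuous.
  by apply: continuousD; apply: lnc.
- move=> [p q] [/= pK qK] pqmax; rewrite /G /= mulrDr.
  have [p1 p2] := andP pK; have [q1 q2] := andP qK.
  have lp := lnr _ pK; have lq := lnr _ qK.
  have p0 : 0 < sqn (p - a) by exact: lt_le_trans p1.
  have q0 : 0 < sqn (q - a) by exact: lt_le_trans q1.
  have [bd|nbd] := pselect (sqn (p - a) = r \/ sqn (q - a) = r \/ p = q).
    have := excess_boundary p q p2 q2 bd; lra.
  (* With one point on the inner sphere, [excess] is at most [M], and this [M] is cancelled by eps
     ln eta. *)
  have inner z : sqn (z - a) = eta -> z = p \/ z = q ->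
      excess u x0 A B (p, q) + (eps * ln (sqn (p - a)) + eps * ln (sqn (q - a))) <=
      eps * (2 * ln r).
    move=> e zpq.
    have : excess u x0 A B (p, q) <= M.
      have := u_osc p q p2 q2; rewrite /excess /=.
      have : 0 <= A * root4 (sqn (p - q)).
        by apply: mulr_ge0; [exact: modulus_ge0|exact: root4_ge0].
      have : 0 <= B * (sqn (p - x0) + sqn (q - x0)).
        by rewrite mulr_ge0 ?penalty_ge0// addr_ge0 ?sqn_ge0.
      lra.
    case: zpq e => -> e; rewrite e; lra.
  have [e|ep] := eqVneq (sqn (p - a)) eta; first by apply: inner e _; left.
  have [e|eq] := eqVneq (sqn (q - a)) eta; first by apply: inner e _; right.
  have pr : sqn (p - a) != r by apply/eqP => ?; apply: nbd; left.
  have qr : sqn (q - a) != r by apply/eqP => ?; apply: nbd; right; left.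
  have pq : p != q by apply/eqP => ?; apply: nbd; right; right.
  (* The two points are now distinct and interior to the annuli, hence away from [a], so jets of [u]
     exist at both. *)
  exfalso.
  have pI : eta < sqn (p - a) < r by rewrite !lt_neqAle eq_sym ep pr p1 p2.
  have qI : eta < sqn (q - a) < r by rewrite !lt_neqAle eq_sym eq qr q1 q2.
  have p0r : 0 < sqn (p - a) < r by case/andP: pI => _ ->; rewrite p0.
  have q0r : 0 < sqn (q - a) < r by case/andP: qI => _ ->; rewrite q0.
  have [Jp [Hp [jp hp]]] := u_jet p p0r; have [Jq [Hq [jq hq]]] := u_jet q q0r.
  have z0 : p - q != 0 by rewrite subr_eq0.
  have X0 : p - a != 0 by rewrite -sqn_gt0.
  have Y0 : q - a != 0 by rewrite -sqn_gt0.
  have [v [w]] := exists_positive_direction Jp Jq Hp Hq (fun i => (u p - u q) 0 i) C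
    hp hq (u_small p q p2 q2) (p - q) (p - a) (q - a) A B eps (root4 (sqn (p - q)))
    m2 z0 X0 Y0 (ltW eps0) penalty_ge0 (penalty_lt p q p2 q2 pq).
  rewrite ltNge => /negP; apply.
  have lnline (z d : 'rV[R]_m) : 0 < sqn (z - a) ->
      second_order_jet (fun t => ln (sqn (z + t *: d - a)))
        (2 * dot (z - a) d / sqn (z - a)) (second_ln (z - a) d).
    move=> z_gt0; have f0 : 0 < sqn (z - a + 0 *: d) by rewrite scale0r addr0.
    have := jet_ln _ _ _ (jet_sqn_line (z - a) d) f0.
    rewrite scale0r addr0; congr (second_order_jet _ _ _).
    by apply/funext => t; rewrite addrAC.
  have jL := jetZ eps _ _ _
    (jetD _ _ _ _ _ _ (lnline p v p0) (lnline q w q0)).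
  apply: (excess_second_test u x0 A B p q v w Jp Jq Hp Hq _ _ _ pq _ _ jL) => //.
  rewrite !scale0r !addr0.
  near=> t; apply: (pqmax (p + t *: v, q + t *: w)); split => /=.
  + have : eta < sqn (p + t *: v - a) < r.
      by near: t; exact: (near_line p v _ (open_annulus a eta r)).
    by move=> /andP[? ?]; rewrite !ltW.
  + have : eta < sqn (q + t *: w - a) < r.
      by near: t; exact: (near_line q w _ (open_annulus a eta r)).
    by move=> /andP[? ?]; rewrite !ltW.
Unshelve. all: by end_near. Qed.

Lemma excess_le0 (x y : 'rV[R]_m) : (2 <= m)%N ->
  0 < sqn (x - a) <= r -> 0 < sqn (y - a) <= r -> excess u x0 A B (x, y) <= 0.
Proof.
move=> m2 hx hy.
pose k := 2 * ln r - (ln (sqn (x - a)) + ln (sqn (y - a))).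
have k0 : 0 <= k.
  have [x1 x2] := andP hx; have [y1 y2] := andP hy.
  have l1 : ln (sqn (x - a)) <= ln r by rewrite ler_ln ?posrE.
  have l2 : ln (sqn (y - a)) <= ln r by rewrite ler_ln ?posrE.
  rewrite /k; lra.
apply/ler_addgt0Pr => e e0; rewrite add0r.
(* For this fixed pair [excess] is at most eps k; the choice e/(k + 1) keeps this below [e], also
   when k = 0. *)
have eps0 : 0 < e / (k + 1) by rewrite divr_gt0//; lra.
have := excess_ln_le x y _ m2 eps0 hx hy.
rewrite -lerBrDr -mulrBr -/k => /le_trans; apply.
rewrite mulrAC ler_pdivrMr; last by lra.
by rewrite ler_pM2l//; lra.
Qed.

Lemma excess_le0_dim1 (x y : 'rV[R]_m) : m = 1%N ->
  sqn (x - a) <= r -> sqn (y - a) <= r -> excess u x0 A B (x, y) <= 0.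
Proof.
move=> m1 xr yr.
pose K := [set p : 'rV[R]_m * 'rV[R]_m |
  0 <= sqn (p.1 - a) <= r /\ 0 <= sqn (p.2 - a) <= r].
suff H : forall p, K p -> excess u x0 A B p <= 0.
  by apply: (H (x, y)); split => /=; rewrite sqn_ge0.
apply: compact_max_principle.
- have -> : K = [set x | 0 <= sqn (x - a) <= r] `*` [set x | 0 <= sqn (x - a) <= r].
    by apply/seteqP; split.
  by apply: compact_setX; exact: compact_annulus.
- move=> [p q] [/= /andP[_ p2] /andP[_ q2]].
  by apply: excess_continuous; exact: u_continuous.
(* The function is symmetric in its two points and nonpositive on the diagonal, so the first point
   may be taken different from [a]. *)
- suff sym : forall p q, K (p, q) -> p != a ->
      (forall z, K z -> excess u x0 A B z <= excess u x0 A B (p, q)) ->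
      excess u x0 A B (p, q) <= 0.
    move=> [p q] [/= pK qK] mx.
    have [e|pa] := eqVneq p a; last exact: sym.
    have [e2|qa] := eqVneq q a.
      apply: excess_boundary; rewrite ?e ?e2 ?subrr ?sqn0 ?ltW//.
      by right; right.
    have swap s t : excess u x0 A B (s, t) = excess u x0 A B (t, s).
      by rewrite /excess /= sqnBC (sqnBC s t) (addrC (sqn (s - x0))).
    rewrite swap; apply: sym => // [[s t] [/= sK tK]].
    by rewrite swap (swap q p); exact: mx.
  move=> p q [/= /andP[_ p2] /andP[_ q2]] pa mx.
  have [bd|nbd] := pselect (sqn (p - a) = r \/ sqn (q - a) = r \/ p = q).
    exact: excess_boundary bd.
  exfalso.
  have pr : sqn (p - a) != r by apply/eqP => ?; apply: nbd; left.
  have pq : p != q by apply/eqP => ?; apply: nbd; right; right.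
  have p0r : 0 < sqn (p - a) < r by rewrite sqn_gt0 subr_eq0 pa lt_neqAle pr.
  have [Jp [Hp [jp hp]]] := u_jet p p0r.
  have z0 : p - q != 0 by rewrite subr_eq0.
  pose v : 'rV[R]_m := const_mx 1.
  have i0 : 'I_m by rewrite m1; exact: ord0.
  have all0 (i : 'I_m) : i = i0.
    by apply: val_inj; case: i i0 => [i hi] [j hj] /=; rewrite m1 in hi hj; case: i j hi hj => [|?] [|?].
  have sum1 (F : 'I_m -> R) : \sum_i F i = F i0.
    by rewrite (bigD1 i0)//= big1 ?addr0// => i; rewrite (all0 i) eqxx.
  have sqv : sqn v = 1 by rewrite /sqn sum1 mxE expr1n.
  have qv (H : 'M[R]_m) : qform H v = \tr H.
    by rewrite /qform /mxtrace !sum1 !mxE !mul1r.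
  have dv (z : 'rV[R]_m) : dot z v ^+ 2 = sqn z.
    by rewrite /dot /sqn !sum1 !mxE mulr1.
  have h0 (i : 'I_n) : `|\tr (0 : 'M[R]_m)| <= C * \sum_(j < n) sqn (0 : 'rV[R]_m).
    by rewrite mxtrace0 normr0 big1 ?mulr0// => j _; rewrite sqn0.
  have := positive_direction_line Jp (fun=> 0) Hp (fun=> 0) (fun i => (u p - u q) 0 i) C
    hp (u_small p q p2 q2) (p - q) v A B (root4 (sqn (p - q))) m1 sqv z0
    (penalty_lt p q p2 q2 pq) qv dv.
  apply/negP; rewrite -leNgt.
  (* The second point does not move, so its jet is that of a constant, even if it is the singular
     point. *)
  have jq (i : 'I_n) : second_order_jet (fun t => u (q + t *: 0) 0 i)
      (dot (0 : 'rV[R]_m) 0) (qform (0 : 'M[R]_m) 0).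
    rewrite dot0r qform0; under eq_fun do rewrite scaler0 addr0.
    exact: jet_cst.
  have := excess_second_test u x0 A B p q v 0 Jp (fun=> 0) Hp (fun=> 0) _ _ _
     pq (jp v) jq (jet_cst 0).
  rewrite subr0 sqn0 mulr0 !addr0; apply.
  near=> t; rewrite scaler0 !addr0; apply: mx; split => /=; last by rewrite sqn_ge0.
  have : 0 < sqn (p + t *: v - a) < r.
    by near: t; exact: (near_line p v _ (open_annulus a 0 r)).
  by move=> /andP[? ?]; rewrite !ltW.
Unshelve. all: by end_near. Qed.

End fixed_center.

(** Centring the penalty at [x] kills its first term, and the second, B |y - x|^2, is absorbed into
    the modulus. *)
Lemma holder_of_excess (x y : 'rV[R]_m) : sqn (x - a) <= r / 4 ->
  sqn (y - a) <= r -> excess u x A B (x, y) <= 0 ->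
  sqn (u x - u y) <= (A + B * root4 (4 * r) ^+ 3) * root4 (sqn (x - y)).
Proof.
move=> hx hy; rewrite /excess /= subrr sqn0 add0r (mulrDl A) => h.
have hx' : sqn (x - a) <= r by have := r_gt0; lra.
have : B * sqn (y - x) <= B * root4 (4 * r) ^+ 3 * root4 (sqn (x - y)).
  rewrite -mulrA ler_wpM2l ?penalty_ge0// (sqnBC y) le_mul_root4// sqn_ge0.
  by rewrite sqn_ball_le.
lra.
Qed.

Lemma holder_estimate : exists2 K : R, 0 <= K &
  forall x y, sqn (x - a) <= r / 4 -> sqn (y - a) <= r / 4 ->
  sqn (u x - u y) <= K * root4 (sqn (x - y)).
Proof.
pose K := A + B * root4 (4 * r) ^+ 3.
have K0 : 0 <= K.
  apply: addr_ge0; first exact: modulus_ge0.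
  by apply: mulr_ge0; [exact: penalty_ge0|rewrite exprn_ge0// root4_ge0].
exists K => //.
have r4 x : sqn (x - a) <= r / 4 -> sqn (x - a) <= r by have := r_gt0; lra.
have [m0|m_gt0] := posnP m.
  move=> x y _ _; have -> : x = y.
    by apply/rowP => i; exfalso; case: i => i; rewrite m0.
  by rewrite subrr sqn0 mulr_ge0// root4_ge0.
have [m1|mn1] := eqVneq m 1%N.
  move=> x y hx hy; apply: holder_of_excess => //; first exact: r4.
  by apply: excess_le0_dim1 => //; exact: r4.
have m2 : (2 <= m)%N by rewrite ltn_neqAle eq_sym mn1.
have off x y : sqn (x - a) <= r / 4 -> sqn (y - a) <= r -> x != a -> y != a ->
    sqn (u x - u y) <= K * root4 (sqn (x - y)).
  move=> hx hy xa ya; apply: holder_of_excess => //.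
  apply: excess_le0 => //; first by rewrite sqn_gt0 subr_eq0 xa r4.
  by rewrite sqn_gt0 subr_eq0 ya hy.
(* A failure of the estimate at the pair [(x, a)] would persist, by continuity, at some point near
   [a] and different from it, where [off] applies. *)
have lim x : sqn (x - a) <= r / 4 -> x != a ->
    sqn (u x - u a) <= K * root4 (sqn (x - a)).
  move=> hx xa; rewrite leNgt; apply/negP => lt.
  pose f y := sqn (u x - u y) - K * root4 (sqn (x - y)).
  have ca : {for a, continuous u} by apply: u_continuous; rewrite subrr sqn0 ltW.
  have cs : {for a, continuous (fun y : 'rV[R]_m => sqn (x - y))}.
    apply: (@continuous_comp _ _ _ (fun y : 'rV[R]_m => x - y)); last exact: sqn_continuous.
    by apply: continuousB; [exact: cst_continuous|exact: cvg_id].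
  have cr : {for a, continuous (fun y : 'rV[R]_m => root4 (sqn (x - y)))}.
    by apply: (continuous_comp cs); exact: root4_continuous.
  have cf : {for a, continuous f}.
    apply: continuousB.
      apply: (@continuous_comp _ _ _ (fun y => u x - u y)); last exact: sqn_continuous.
      by apply: continuousB => //; exact: cst_continuous.
    by apply: continuousM; [exact: cst_continuous|exact: cr].
  have fa : 0 < f a by rewrite /f subr_gt0.
  have fN : \forall y \near a, 0 < f y by apply: (cf (fun s => 0 < s)); exact: lt_nbhsr.
  pose e : 'rV[R]_m := const_mx 1.
  have rN : \forall t \near (0 : R), sqn (a + t *: e - a) < r.
    (* The lower bound -1 turns the annulus into a full open ball, which contains [a]. *)
    have oB : open [set z | - 1 < sqn (z - a) < r] by exact: open_annulus.
    have aB : [set z | - 1 < sqn (z - a) < r] a.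
      by rewrite /= subrr sqn0 r_gt0 andbT; lra.
    by apply: filterS (near_line a e _ oB aB) => t /andP[].
  have lN : \forall t \near (0 : R), 0 < f (a + t *: e).
    have : {for 0, continuous (fun t : R => a + t *: e)}.
      by apply: continuousD; [exact: cst_continuous|exact: scalel_continuous].
    move=> c; have c' : \forall y \near (a + 0 *: e), 0 < f y by rewrite scale0r addr0.
    exact: (c _ c').
  have [d /= d0 Hd] := filterI rN lN.
  have [h1 h2] : sqn (a + (d / 2) *: e - a) < r /\ 0 < f (a + (d / 2) *: e).
    by apply: Hd; rewrite /= sub0r normrN gtr0_norm; lra.
  have ya : a + (d / 2) *: e != a.
    rewrite -subr_eq0 addrAC subrr add0r; apply/eqP => /rowP/(_ (Ordinal m_gt0)).
    rewrite !mxE mulr1; lra.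
  have := off x _ hx (ltW h1) xa ya; move: h2; rewrite /f; lra.
move=> x y hx hy.
have [->|xa] := eqVneq x a; have [->|ya] := eqVneq y a.
- by rewrite !subrr !sqn0 mulr_ge0// root4_ge0.
- by rewrite sqnBC (sqnBC a); exact: lim.
- exact: lim.
- by apply: off => //; exact: r4.
Qed.

End isolated_singularity.
(** * Jets of maps of class C^2 along lines *)

Section class_C2.
Context {R : realType} {m : nat}.
Implicit Types (x v : 'rV[R]_m).

Lemma is_derive_line {W : normedModType R} (f : 'rV[R]_m -> W) x v (t : R) :
  derivable f (x + t *: v) v ->
  is_derive t (1 : R) (fun s => f (x + s *: v)) ('D_v f (x + t *: v)).
Proof.
move=> df.
have E : (fun h : R => h^-1 *: (((fun s => f (x + s *: v)) \o shift t) (h *: (1 : R)) -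
      f (x + t *: v))) =
    (fun h => h^-1 *: ((f \o shift (x + t *: v)) (h *: v) - f (x + t *: v))).
  apply/funext => h /=; congr (_ *: (f _ - _)).
  have -> : h *: (1 : R) = h by rewrite /GRing.scale /= mulr1.
  by rewrite scalerDl addrCA.
by split; rewrite ?/derivable ?/derive E.
Qed.

Lemma derive_pderiv {W : normedModType R} (f : 'rV[R]_m -> W) x v :
  differentiable f x -> 'D_v f x = \sum_j v 0 j *: pderiv j f x.
Proof.
move=> df; rewrite deriveE// {1}[v]row_sum_delta linear_sum; apply: eq_bigr => j _.
by rewrite linearZ /pderiv deriveE.
Qed.

Lemma derive_coord {n : nat} (f : 'rV[R]_m -> 'rV[R]_n) x v i :
  differentiable f x -> 'D_v (fun y => f y 0 i) x = 'D_v f x 0 i.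
Proof.
by move=> df; rewrite derive_mx ?mxE//; exact: diff_derivable.
Qed.

Lemma differentiable_entry {n : nat} (f : 'rV[R]_m -> 'rV[R]_n) x i :
  differentiable f x -> differentiable (fun y => f y 0 i) x.
Proof.
move=> df; apply: (@differentiable_comp _ _ _ _ f (fun w : 'rV[R]_n => w 0 i)) => //.
exact: differentiable_coord.
Qed.

(** Near [x] the derivative along the line is the sum of the v_j times the first partials of [f],
    and each partial is itself differentiable at [x]. *)
Lemma jet_C2 {n : nat} (f : 'rV[R]_m -> 'rV[R]_n) (O : set 'rV[R]_m) x v i :
  open O -> O x -> Ck 2 O f ->
  second_order_jet (fun t => f (x + t *: v) 0 i)
    (dot (\row_j pderiv j f x 0 i) v)
    (qform (\matrix_(j, k) pderiv k (pderiv j f) x 0 i) v).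
Proof.
move=> oO Ox [df d2f].
exists (fun t => \sum_j v 0 j * pderiv j f (x + t *: v) 0 i); split.
- apply: filterS (near_line x v O oO Ox) => t Ot.
  have dt := df _ Ot.
  have -> : \sum_j v 0 j * pderiv j f (x + t *: v) 0 i =
      'D_v (fun y => f y 0 i) (x + t *: v).
    rewrite derive_coord// derive_pderiv// summxE.
    by apply: eq_bigr => j _; rewrite mxE.
  apply: (@is_derive_line _ (fun y => f y 0 i)).
  by apply: diff_derivable; exact: differentiable_entry.
- by rewrite scale0r addr0; apply: eq_bigr => j _; rewrite mxE mulrC.
- have -> : (fun t => \sum_j v 0 j * pderiv j f (x + t *: v) 0 i) =
      \sum_j (fun t => v 0 j * pderiv j f (x + t *: v) 0 i).
    by apply/funext => t; rewrite fct_sumE.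
  apply: is_derive_sum => j; set q := \sum_k _.
  have [dj _] := d2f j; have djx := dj _ Ox.
  have -> : q = v 0 j *: 'D_v (fun y => pderiv j f y 0 i) (x + 0 *: v).
    rewrite scale0r addr0 derive_coord// derive_pderiv// summxE scaler_sumr.
    by apply: eq_bigr => k _; rewrite !mxE /GRing.scale /= mulrA.
  have d : is_derive (0 : R) (1 : R) (fun t => pderiv j f (x + t *: v) 0 i)
      ('D_v (fun y => pderiv j f y 0 i) (x + 0 *: v)).
    apply: (@is_derive_line _ (fun y => pderiv j f y 0 i)).
    rewrite scale0r addr0.
    by apply: diff_derivable; exact: differentiable_entry.
  exact: is_deriveZ.
Qed.

(** Taking a coordinate commutes with the first derivative on all of the open set [O], hence near
    [x], so the identity can be differentiated again. *)
Lemma pderiv2_coord {n : nat} (f : 'rV[R]_m -> 'rV[R]_n) (O : set 'rV[R]_m) x i j k :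
  open O -> O x -> Ck 2 O f ->
  pderiv k (pderiv j (fun y => f y 0 i)) x = pderiv k (pderiv j f) x 0 i.
Proof.
move=> oO Ox [df d2f]; have [dj _] := d2f j.
rewrite -(derive_coord _ _ _ _ (dj _ Ox)) /pderiv; apply: near_eq_derive.
have : \forall y \near x, O y by exact: open_nbhs_nbhs.
by apply: filterS => y /df dy; rewrite derive_coord.
Qed.

Lemma Ck_subset {W : normedModType R} k (A B : set 'rV[R]_m) (f : 'rV[R]_m -> W) :
  B `<=` A -> Ck k A f -> Ck k B f.
Proof.
move=> BA; elim: k f => [|k IH] f /=; first by move=> h x /BA; exact: h.
by move=> [h1 h2]; split; [move=> x /BA; exact: h1|move=> i; exact: IH].
Qed.

(** Passes from sup norm balls to Euclidean ones: each squared entry is at most the squared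
    Euclidean length. Here [r] bounds the squared distance. *)
Lemma nbhs_sqn_ball (a : 'rV[R]_m) (P : set 'rV[R]_m) : nbhs a P ->
  exists2 r : R, 0 < r & forall x, sqn (x - a) <= r -> P x.
Proof.
move=> /nbhs_ballP[e /= e0 He]; exists ((e / 2) ^+ 2).
  by rewrite exprn_gt0// divr_gt0.
move=> x xa; apply: He; rewrite -ball_normE /ball_ /= -normrN opprB.
apply: (@le_lt_trans _ _ (e / 2)); last by rewrite ltr_pdivrMr// mulr_natr mulr2n ltrDl.
rewrite [leLHS]/Num.norm /= mx_normrE; apply: bigmax_le; first by rewrite ltW// divr_gt0.
move=> [i j] _ /=; rewrite ord1.
rewrite -(@ler_pXn2r _ 2) ?nnegrE// ?real_normK ?num_real//; last by rewrite ltW// divr_gt0.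
apply: le_trans xa; rewrite /sqn (bigD1 j)//= lerDl.
by apply: sumr_ge0 => k _; exact: sqr_ge0.
Qed.

End class_C2.

(** * Continuity of determinants and inverse matrices *)

Section continuity_of_inverse_matrices.
Context {R : realType} {T : topologicalType}.

Lemma continuous_sum_at {I : Type} (s : seq I) (P : pred I) (f : I -> T -> R) (y : T) :
  (forall i, P i -> {for y, continuous (f i)}) ->
  {for y, continuous (fun x => \sum_(i <- s | P i) f i x)}.
Proof.
move=> H; elim: s => [|i s IH].
  have -> : (fun x => \sum_(i <- [::] | P i) f i x) = (fun=> 0).
    by apply/funext => x; rewrite big_nil.
  exact: cst_continuous.
have -> : (fun x => \sum_(i <- i :: s | P i) f i x) =
    (fun x => if P i then f i x + \sum_(i <- s | P i) f i x
              else \sum_(i <- s | P i) f i x).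
  by apply/funext => x; rewrite big_cons.
by case: (boolP (P i)) => // Pi; apply: continuousD => //; exact: H.
Qed.

Lemma continuous_prod_at {I : Type} (s : seq I) (f : I -> T -> R) (y : T) :
  (forall i, {for y, continuous (f i)}) ->
  {for y, continuous (fun x => \prod_(i <- s) f i x)}.
Proof.
move=> H; elim: s => [|i s IH].
  have -> : (fun x => \prod_(i <- [::]) f i x) = (fun=> 1).
    by apply/funext => x; rewrite big_nil.
  exact: cst_continuous.
have -> : (fun x => \prod_(i <- i :: s) f i x) =
    (fun x => f i x * \prod_(i <- s) f i x).
  by apply/funext => x; rewrite big_cons.
exact: continuousM.
Qed.

Lemma continuous_det {k : nat} (G : T -> 'M[R]_k) (y : T) :
  (forall i j, {for y, continuous (fun x => G x i j)}) ->
  {for y, continuous (fun x => \det (G x))}.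
Proof.
move=> H; apply: continuous_sum_at => s _.
apply: continuousM; first exact: cst_continuous.
by apply: continuous_prod_at => i; exact: H.
Qed.

(** Since [invmx] is defined by cases, Cramer's formula is used near [y], where the determinant does
    not vanish. *)
Lemma continuous_invmx {k : nat} (G : T -> 'M[R]_k) (y : T) i j :
  (forall i j, {for y, continuous (fun x => G x i j)}) -> \det (G y) != 0 ->
  {for y, continuous (fun x => invmx (G x) i j)}.
Proof.
move=> H d0; have cd := continuous_det G y H.
have dN : \forall x \near y, \det (G x) != 0.
  by apply: (cd (fun s => s != 0)); exact: open_nbhs_nbhs.
have E : \forall x \near y, (\det (G x))^-1 * cofactor (G x) j i = invmx (G x) i j.
  by apply: filterS dN => x dx; rewrite /invmx unitmxE unitfE dx !mxE.
have Ey : (\det (G y))^-1 * cofactor (G y) j i = invmx (G y) i j by exact: nbhs_singleton E.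
have cM : {for y, continuous (fun x => (\det (G x))^-1 * cofactor (G x) j i)}.
  apply: continuousM; first exact: continuousV.
  apply: continuousM; first exact: cst_continuous.
  apply: continuous_det => i' j'.
  have -> : (fun x => row' j (col' i (G x)) i' j') =
      (fun x => G x (lift j i') (lift i j')).
    by apply/funext => x; rewrite !mxE.
  exact: H.
rewrite /prop_for /continuous_at -Ey.
exact: cvg_trans (near_eq_cvg E) cM.
Qed.

Lemma continuous_locally_bounded (f : T -> R) (y : T) : {for y, continuous f} ->
  \forall x \near y, `|f x| <= `|f y| + 1.
Proof.
move=> cf; have c : {for y, continuous (fun x => `|f x|)}.
  by apply: continuous_comp => //; exact: norm_continuous.
have N : \forall s \near `|f y|, s < `|f y| + 1 by apply: lt_nbhsl; rewrite ltrDl.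
have H : \forall x \near y, `|f x| < `|f y| + 1 := c _ N.
by apply: filterS H => x /ltW.
Qed.

End continuity_of_inverse_matrices.
Lemma continuous_at_within {S T : topologicalType} (A : set S) (f : S -> T) (x : S) :
  open A -> {within A, continuous f} -> A x -> {for x, continuous f}.
Proof.
by move=> oA; rewrite continuous_open_subspace// => cf Ax; apply: cf; rewrite inE.
Qed.

(** * The Christoffel symbols in a chart *)

Section charts.
Context {R : realType} {n : nat} (N : smooth_manifold R n).
Implicit Types (phi psi chi : chart R n N) (P : N).

Lemma chart_at_cimg phi P : chart_at P phi -> cimg phi (cmap phi P).
Proof. by case=> _ dP; exists P. Qed.

Lemma cinv_continuous_at phi P : chart_at P phi ->
  {for cmap phi P, continuous (cinv phi)}.
Proof.
move=> hP; apply: (continuous_at_within (cimg phi)).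
- exact: open_cimg.
- exact: cinv_continuous.
- exact: chart_at_cimg.
Qed.

Lemma near_chart phi psi P : chart_at P phi -> chart_at P psi ->
  \forall y \near cmap phi P, cdom psi (cinv phi y).
Proof.
move=> hP [_ dP]; apply: (cinv_continuous_at _ _ hP).
case: hP => _ hP; rewrite cmapK//.
by apply: open_nbhs_nbhs; split => //; exact: open_cdom.
Qed.

Lemma transition_differentiable phi psi P : chart_at P phi -> chart_at P psi ->
  differentiable (transition phi psi) (cmap phi P).
Proof.
move=> [aphi dphi] [apsi dpsi].
have [[H _] _] := matlas_compatible aphi apsi 1.
by apply: H; exists P.
Qed.

Lemma diff_near_eq (f g : 'rV[R]_n -> 'rV[R]_n) y v :
  differentiable f y -> differentiable g y -> (\near y, f y = g y) ->
  'd f y v = 'd g y v.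
Proof.
move=> df dg fg; have e1 := deriveE v df; have e2 := deriveE v dg.
have e3 := near_eq_derive v fg.
by rewrite e1 e2 in e3.
Qed.

Lemma diff_comp_near (f g k : 'rV[R]_n -> 'rV[R]_n) y z v :
  differentiable f y -> f y = z -> differentiable g z -> differentiable k y ->
  (\near y, g (f y) = k y) -> 'd g z ('d f y v) = 'd k y v.
Proof.
move=> df <- dg dk gfk.
have e : 'd (g \o f) y v = 'd g (f y) ('d f y v).
  exact: (congr1 (fun F : _ -> _ => F v) (diff_comp df dg)).
apply: (etrans (esym e)); apply: diff_near_eq => //.
exact: differentiable_comp.
Qed.

Lemma transition_at phi psi P : chart_at P phi ->
  transition phi psi (cmap phi P) = cmap psi P.
Proof. by case=> _ dP; rewrite /transition cmapK. Qed.

(** The cocycle identity of the transition maps holds on a whole neighbourhood of [cmap phi P], so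
    the chain rule differentiates it. *)
Lemma diff_transition_comp phi psi chi P v : chart_at P phi -> chart_at P psi ->
  chart_at P chi ->
  'd (transition psi chi) (cmap psi P) ('d (transition phi psi) (cmap phi P) v) =
  'd (transition phi chi) (cmap phi P) v.
Proof.
move=> hphi hpsi hchi.
apply: diff_comp_near.
- exact: transition_differentiable.
- exact: transition_at.
- exact: transition_differentiable.
- exact: transition_differentiable.
- apply: filterS (near_chart _ _ _ hphi hpsi) => y dy.
  by rewrite /transition cmapK.
Qed.

Lemma diff_transition_id phi P v : chart_at P phi ->
  'd (transition phi phi) (cmap phi P) v = v.
Proof.
move=> hphi; transitivity ('d (id : 'rV[R]_n -> 'rV[R]_n) (cmap phi P) v).
  apply: diff_near_eq => //; first exact: transition_differentiable.
  have : \forall y \near cmap phi P, cimg phi y.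
    apply: open_nbhs_nbhs; split; first exact: open_cimg.
    exact: chart_at_cimg.
  by apply: filterS => y [Q dQ <-]; rewrite /transition cmapK.
by rewrite diff_val.
Qed.

Lemma coord_vector_tangent phi P i : chart_at P phi ->
  tangent P (coord_vector phi P i).
Proof.
move=> hphi; split => [psi npsi|psi chi hpsi hchi].
  by rewrite /coord_vector asboolF.
rewrite /coord_vector !asboolT//; apply: esym; exact: diff_transition_comp.
Qed.

Lemma tangent_linear P (c : R) v w : tangent P v -> tangent P w ->
  tangent P (c *: v + w).
Proof.
move=> [v0 v1] [w0 w1]; split => [psi npsi|psi chi hpsi hchi].
  by rewrite !fctE v0// w0// scaler0 addr0.
have e1 := v1 psi chi hpsi hchi; have e2 := w1 psi chi hpsi hchi.
apply: (etrans (congr2 (fun x y => c *: x + y) e1 e2)); apply: esym.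
exact: linearP.
Qed.

Lemma tangent0 P : @tangent R n N P 0.
Proof.
split => [//|psi chi hpsi hchi]; apply: esym; exact: linear0.
Qed.

Lemma tangent_sum P (c : 'I_n -> R) (e : 'I_n -> chart R n N -> 'rV[R]_n) (s : seq 'I_n) :
  (forall i, tangent P (e i)) -> tangent P (\sum_(i <- s) c i *: e i).
Proof.
move=> he; elim: s => [|i s IH]; first by rewrite big_nil; exact: tangent0.
by rewrite big_cons; exact: tangent_linear.
Qed.

(** The entry of a tangent vector in one chart determines all the others, linearly, through the
    differentials of the transition maps. *)
Lemma tangent_expansion phi P w : chart_at P phi -> tangent P w ->
  w = \sum_(j < n) w phi 0 j *: coord_vector phi P j.
Proof.
move=> hphi [w0 w1]; apply/funext => psi; rewrite fct_sumE.
have [hpsi|npsi] := pselect (chart_at P psi); last first.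
  rewrite w0// big1// => j _.
  by rewrite fctE /coord_vector asboolF// scaler0.
apply: (etrans (w1 phi psi hphi hpsi)).
have e := congr1 ('d (transition phi psi) (cmap phi P)) (row_sum_delta (w phi)).
apply: (etrans e); apply: (etrans (linear_sum _ _ _ _)); apply: eq_bigr => j _.
apply: (etrans (linearZZ _ _ _)).
by rewrite fctE /coord_vector asboolT.
Qed.

Lemma form_sum (h : form_field N) P (c : 'I_n -> R)
    (e : 'I_n -> chart R n N -> 'rV[R]_n) w (s : seq 'I_n) :
  symmetric_bilinear_at h P -> (forall i, tangent P (e i)) -> tangent P w ->
  h P (\sum_(i <- s) c i *: e i) w = \sum_(i <- s) c i * h P (e i) w.
Proof.
move=> [_ hl] he hw; elim: s => [|i s IH].
  (* Linearity with coefficient 1 and two zero vectors reads h(0, w) = h(0, w) + h(0, w), so the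
     value is 0. *)
  rewrite !big_nil; have := hl 1 0 0 w (tangent0 P) (tangent0 P) hw.
  rewrite scaler0 addr0 mul1r => /eqP; rewrite -subr_eq subrr => /eqP <-.
  by [].
by rewrite !big_cons hl// ?IH//; exact: tangent_sum.
Qed.

(** A row [c] in the kernel of the matrix gives a tangent vector with components [c] that is
    orthogonal to every tangent vector. It vanishes by nondegeneracy, and its entry in [phi] is
    [c]. *)
Lemma metric_matrix_nondegenerate (h : form_field N) phi P :
  symmetric_bilinear_at h P -> nondegenerate_at h P -> chart_at P phi ->
  \det (metric_matrix h phi (cmap phi P)) != 0.
Proof.
move=> hsb hnd hphi; apply/negP => /det0P[c c0 cG].
have cK : cinv phi (cmap phi P) = P by case: (hphi) => _ ?; rewrite cmapK.
pose e := coord_vector phi P.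
have he i : tangent P (e i) by exact: coord_vector_tangent.
pose V := \sum_(i < n) c 0 i *: e i.
have tV : tangent P V by exact: tangent_sum.
have V0 : V = 0.
  apply: hnd => // w tw; rewrite (hsb.1 V w)//.
  rewrite (tangent_expansion _ _ _ hphi tw) form_sum// big1// => j _.
  rewrite (hsb.1 _ V)// form_sum//.
  have := congr1 (fun M : 'rV[R]_n => M 0 j) cG; rewrite !mxE => E.
  rewrite -[X in _ * X](_ : 0 = _) ?mulr0// -[LHS]E.
  by apply: eq_bigr => i _; rewrite !mxE /metric_coef cK.
move/negP: c0; apply; apply/eqP.
have := congr1 (fun W : chart R n N -> 'rV[R]_n => W phi) V0.
rewrite /V fct_sumE => E.
rewrite [c]row_sum_delta -[RHS]E; apply: eq_bigr => i _.
rewrite fctE /e /coord_vector asboolT//; congr (_ *: _); apply: esym.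
exact: diff_transition_id.
Qed.

(** The symbols are continuous at the point: coefficients and their first derivatives are
    continuous, and the metric matrix is invertible there. *)
Lemma christoffel_locally_bounded (p q : nat) (h : form_field N) phi P :
  pseudo_riemannian p q h -> metric_class 2 h -> chart_at P phi ->
  exists2 c : R, 0 <= c & \forall y \near cmap phi P,
    forall i j k, `|christoffel h phi i j k y| <= c.
Proof.
move=> hh hC hphi; set y0 := cmap phi P.
have [hsb hnd _] := hh P.
have d0 := metric_matrix_nondegenerate h phi P hsb hnd hphi.
have iy : cimg phi y0 by exact: chart_at_cimg.
have Ch i j : Ck 2 (cimg phi) (metric_coef h phi i j) by apply: hC; case: hphi.
have cG i j : {for y0, continuous (fun y => metric_matrix h phi y i j)}.
  have -> : (fun y => metric_matrix h phi y i j) = metric_coef h phi i j.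
    by apply/funext => y; rewrite mxE.
  by apply: differentiable_continuous; apply: (Ch i j).1.
have cdG l i j : {for y0, continuous (pderiv l (metric_coef h phi i j))}.
  by apply: differentiable_continuous; apply: ((Ch i j).2 l).1.
have cGamma i j k : {for y0, continuous (christoffel h phi i j k)}.
  apply: continuousM; first exact: cst_continuous.
  apply: continuous_sum_at => l _; apply: continuousM.
    exact: continuous_invmx.
  apply: continuousB; last exact: cdG.
  by apply: continuousD; exact: cdG.
(* Near [y0] each symbol is bounded by its absolute value at [y0] plus 1; the sum of these bounds
   serves all index triples at once. *)
pose c0 (t : 'I_n * 'I_n * 'I_n) := `|christoffel h phi t.1.1 t.1.2 t.2 y0| + 1.
have c0_ge0 t : 0 <= c0 t by rewrite addr_ge0.
exists (\sum_t c0 t); first by apply: sumr_ge0.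
have H : \forall y \near y0, forall t : 'I_n * 'I_n * 'I_n,
    `|christoffel h phi t.1.1 t.1.2 t.2 y| <= \sum_t c0 t.
  apply: (@filter_forall _ _
    (fun t y => `|christoffel h phi t.1.1 t.1.2 t.2 y| <= \sum_t c0 t) (nbhs y0)) => t.
  apply: filterS (continuous_locally_bounded _ _ (cGamma t.1.1 t.1.2 t.2)) => y.
  move=> /le_trans; apply.
  by rewrite (bigD1 t)//= lerDl sumr_ge0.
by apply: filterS H => y Hy i j k; exact: (Hy (i, j, k)).
Qed.

End charts.

(** * Quadratic growth and finiteness of the Hoelder norm *)

Lemma quadratic_growth {R : realType} {n : nat} (G : 'I_n -> 'I_n -> R)
    (b : 'I_n -> R) (c : R) : (forall j k, `|G j k| <= c) ->
  `|\sum_j \sum_k G j k * b j * b k| <= 2 * n%:R * c * \sum_j b j ^+ 2.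
Proof.
move=> hG.
have step j k : `|G j k * b j * b k| <= c * (b j ^+ 2 + b k ^+ 2).
  rewrite -mulrA normrM; apply: ler_pM => //.
  rewrite normrM -(real_normK (num_real (b j))) -(real_normK (num_real (b k))).
  set x := `|b j|; set y := `|b k|.
  have := sqr_ge0 (x - y); have := sqr_ge0 x; have := sqr_ge0 y; nra.
(* Each b_j^2 now occurs n times through the first index and n times through the second, whence the
   factor 2n. *)
apply: (@le_trans _ _ (\sum_j \sum_k c * (b j ^+ 2 + b k ^+ 2))).
  apply: le_trans (ler_norm_sum _ _ _) _; apply: ler_sum => j _.
  by apply: le_trans (ler_norm_sum _ _ _) _; apply: ler_sum => k _.
have -> : \sum_j \sum_k c * (b j ^+ 2 + b k ^+ 2) =
    \sum_j (c * (n%:R * b j ^+ 2) + c * \sum_k b k ^+ 2).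
  apply: eq_bigr => j _; rewrite -mulr_sumr big_split/= sumr_const card_ord mulrDr.
  by rewrite mulr_natl.
rewrite big_split/= sumr_const card_ord -!mulr_sumr -mulr_natl le_eqVlt.
by apply/orP; left; apply/eqP; ring.
Qed.

Lemma enorm_sqn {R : realType} {m : nat} (x : 'rV[R]_m) : enorm x = Num.sqrt (sqn x).
Proof. by []. Qed.

Lemma powR_quarter {R : realType} (x : R) : 0 <= x -> x `^ 4^-1 = root4 x.
Proof.
move=> x0; have -> : (4^-1 : R) = 2^-1 * 2^-1 by field.
by rewrite powRrM !powR12_sqrt// sqrtr_ge0.
Qed.

(** Taking square roots in |f(x) - f(y)|^2 <= K |x - y|^(1/2) gives the exponent 1/4 and the
    constant sqrt K. *)
Lemma holder_norm_lt_pinfty {R : realType} {m n : nat} (f : 'rV[R]_m -> 'rV[R]_n)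
    (B : set 'rV[R]_m) (K L : R) : 0 <= K ->
  (forall x, B x -> sqn (f x) <= L) ->
  (forall x y, B x -> B y -> sqn (f x - f y) <= K * root4 (sqn (x - y))) ->
  (holder_norm 4^-1 B f < +oo)%E.
Proof.
move=> K0 hL hK; apply: lte_add_pinfty.
- apply: (@le_lt_trans _ _ (Num.sqrt L)%:E); last exact: ltry.
  apply: ub_ereal_sup => _ [x Bx <-]; rewrite lee_fin enorm_sqn.
  by rewrite ler_wsqrtr// hL.
- apply: (@le_lt_trans _ _ (Num.sqrt K)%:E); last exact: ltry.
  apply: ub_ereal_sup => _ [[x y] [/= Bx By xy] <-]; rewrite lee_fin.
  have s0 : 0 < sqn (x - y) by rewrite sqn_gt0 subr_eq0; apply/eqP.
  rewrite !enorm_sqn powR_quarter ?sqrtr_ge0// ler_pdivrMr; last first.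
    by rewrite root4_gt0 sqrtr_gt0.
  have -> : root4 (Num.sqrt (sqn (x - y))) = Num.sqrt (root4 (sqn (x - y))) by [].
  by rewrite -sqrtrM// ler_wsqrtr// hK.
Qed.

(** * The harmonic map equation in a chart *)

Section harmonic_coordinates.
Context {R : realType} {m n : nat} (N : smooth_manifold R n) (h : form_field N).
Variables (A : set 'rV[R]_m) (u : 'rV[R]_m -> N) (phi : chart R n N).

(** The trace is the Laplacian of the i-th coordinate; the harmonic map equation replaces it by the
    Christoffel term, estimated for each [mu] by [quadratic_growth]. *)
Lemma laplacian_quadratic_growth (O : set 'rV[R]_m) (x : 'rV[R]_m) (c : R) i :
  harmonic_map h A u -> matlas phi -> open O -> O x ->
  O `<=` A `&` u @^-1` cdom phi ->
  (forall i j k, `|christoffel h phi i j k (cmap phi (u x))| <= c) ->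
  `|\tr (\matrix_(j, k) pderiv k (pderiv j (fun y => cmap phi (u y))) x 0 i)| <=
  2 * n%:R * c *
  \sum_l sqn (\row_j pderiv j (fun y => cmap phi (u y)) x 0 l).
Proof.
move=> [[_ hu] heq] aphi oO Ox OA hc; set U := fun y => cmap phi (u y).
have CU : Ck 2 O U by apply: Ck_subset (hu phi aphi).
have [Ax dx] := OA _ Ox.
have := heq phi aphi x Ax dx i.
have -> : laplacian (local_coord u phi i) x =
    \tr (\matrix_(j, k) pderiv k (pderiv j U) x 0 i).
  by apply: eq_bigr => k _; rewrite mxE; exact: pderiv2_coord oO Ox CU.
move=> /eqP; rewrite addr_eq0 => /eqP ->; rewrite normrN.
have dU : differentiable U x by exact: CU.1.
have pd mu l : pderiv mu (local_coord u phi l) x = pderiv mu U x 0 l.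
  exact: derive_coord.
apply: le_trans (ler_norm_sum _ _ _) _.
have -> : \sum_l sqn (\row_j pderiv j U x 0 l) =
    \sum_mu \sum_l pderiv mu (local_coord u phi l) x ^+ 2.
  rewrite exchange_big; apply: eq_bigr => l _; apply: eq_bigr => mu _.
  by rewrite mxE pd.
rewrite mulr_sumr; apply: ler_sum => mu _.
by apply: quadratic_growth => j k; exact: hc.
Qed.

End harmonic_coordinates.

(** * Localisation at the singular point and conclusion *)

Theorem theorem2 (R : realType) (m n p q : nat) (hn : (1 <= n)%N)
  (N : smooth_manifold R n) (h : form_field N)
  (hh : pseudo_riemannian p q h) (hC2 : metric_class 2 h)
  (Omega : set 'rV[R]_m) (hOmega : open Omega)
  (a : 'rV[R]_m) (ha : Omega a)
  (u : 'rV[R]_m -> N) (hu : {within Omega, continuous u})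
  (huh : harmonic_map h (Omega `\ a) u) :
  exists alpha : R, (0 < alpha < 1) /\
  exists R1 : R, [/\ 0 < R1, eball a R1 `<=` Omega &
  exists psi : chart R n N,
    [/\ matlas psi, cdom psi (u a), u @` eball a R1 `<=` cdom psi &
        (holder_norm alpha (eball a R1) (fun x => cmap psi (u x)) < +oo)%E]].
Proof.
have [phi aphi dphi] := matlas_cover (u a).
have hphi : chart_at (u a) phi by split.
pose U x := cmap phi (u x).
have cu x : Omega x -> {for x, continuous u}.
  exact: continuous_at_within hOmega hu.
have cU x : Omega x -> cdom phi (u x) -> {for x, continuous U}.
  move=> Ox dx; apply: continuous_comp; first exact: cu.
  exact: continuous_at_within (open_cdom phi) (@cmap_continuous _ _ _ phi) dx.
have [c c0 hc] := christoffel_locally_bounded N p q h phi (u a) hh hC2 hphi.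
pose C := 2 * n%:R * c; have C0 : 0 <= C by rewrite !mulr_ge0.
have cUa := cU a ha dphi.
have cS : {for a, continuous (fun x => 4 * m%:R * C * \sum_i `|(U x - U a) 0 i|)}.
  apply: continuousM; first exact: cst_continuous.
  apply: continuous_sum_at => i _.
  apply: (@continuous_comp _ _ _ (fun x => (U x - U a) 0 i) (fun s : R => `|s|));
    last exact: norm_continuous.
  apply: (@continuous_comp _ _ _ (fun x => U x - U a) (fun w : 'rV[R]_n => w 0 i));
    last exact: coord_continuous.
  by apply: continuousB => //; exact: cst_continuous.
have cQ : {for a, continuous (fun x => sqn (U x - U a))}.
  apply: (@continuous_comp _ _ _ (fun x => U x - U a)); last exact: sqn_continuous.
  by apply: continuousB => //; exact: cst_continuous.
have N1 : \forall x \near a, Omega x by exact: open_nbhs_nbhs.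
have N2 : \forall x \near a, cdom phi (u x).
  by apply: (cu _ ha); apply: open_nbhs_nbhs; split => //; exact: open_cdom.
have N3 : \forall x \near a, forall i j k, `|christoffel h phi i j k (U x)| <= c.
  exact: cUa _ hc.
(* The factor 4m is twice the 2m of the smallness condition, since two points are compared through
   [a]. *)
have N4 : \forall x \near a, 4 * m%:R * C * \sum_i `|(U x - U a) 0 i| < 1.
  apply: (cS (fun s => s < 1)); apply: lt_nbhsl.
  by rewrite big1 ?mulr0// => i _; rewrite subrr mxE normr0.
have N5 : \forall x \near a, sqn (U x - U a) < 1.
  by apply: (cQ (fun s => s < 1)); apply: lt_nbhsl; rewrite subrr sqn0.
(* One closed ball on which all five local conditions hold together. *)
have [r r0 hr] := nbhs_sqn_ball a _
  (filterI N1 (filterI N2 (filterI N3 (filterI N4 N5)))).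
have osc x y : sqn (x - a) <= r -> sqn (y - a) <= r -> sqn (U x - U y) <= 4.
  move=> /hr[_ [_ [_ [_ /= hx]]]] /hr[_ [_ [_ [_ /= hy]]]].
  have := sqn_sub_le (U x) (U a) (U y); rewrite (sqnBC (U a)); lra.
have small x y : sqn (x - a) <= r -> sqn (y - a) <= r ->
    2 * m%:R * (C * \sum_i `|(U x - U y) 0 i|) <= 1.
  move=> /hr[_ [_ [_ [/= hx _]]]] /hr[_ [_ [_ [/= hy _]]]].
  have k0 : 0 <= 2 * m%:R * C by rewrite !mulr_ge0.
  have t : \sum_i `|(U x - U y) 0 i| <=
      \sum_i `|(U x - U a) 0 i| + \sum_i `|(U y - U a) 0 i|.
    rewrite -big_split; apply: ler_sum => i _ /=; rewrite !mxE.
    by rewrite (distrC (U y 0 i)); exact: ler_distD.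
  have := ler_wpM2l k0 t; lra.
have jets x : 0 < sqn (x - a) < r ->
  exists (J : 'I_n -> 'rV[R]_m) (H : 'I_n -> 'M[R]_m),
    (forall v i, second_order_jet (fun t => U (x + t *: v) 0 i)
       (dot (J i) v) (qform (H i) v)) /\
    (forall i, `|\tr (H i)| <= C * \sum_j sqn (J j)).
  move=> hx; pose O := [set z : 'rV[R]_m | 0 < sqn (z - a) < r].
  have oO : open O by exact: open_annulus.
  have OA : O `<=` (Omega `\ a) `&` u @^-1` cdom phi.
    move=> z /andP[z0 zr]; have [h1 [h2 _]] := hr z (ltW zr).
    split => //; split => // /= e.
    by rewrite e subrr sqn0 ltxx in z0.
  exists (fun i => \row_j pderiv j U x 0 i),
    (fun i => \matrix_(j, k) pderiv k (pderiv j U) x 0 i); split.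
    move=> v i; apply: (jet_C2 U O) => //.
    by apply: Ck_subset OA _; case: huh => [[_ hCk] _]; exact: hCk.
  move=> i; apply: (laplacian_quadratic_growth N h (Omega `\ a) u phi O) => //.
  by case/andP: hx => _ /ltW /hr[_ [_ []]].
have cont x : sqn (x - a) <= r -> {for x, continuous U}.
  by move=> /hr[h1 [h2 _]]; exact: cU.
have [K K0 hK] := holder_estimate U a r C 4 r0 cont osc small jets.
(* The radius is chosen so that its square is r/4, the region covered by [holder_estimate]. *)
have ballP x : eball a (Num.sqrt r / 2) x -> sqn (x - a) <= r / 4.
  rewrite /eball /= enorm_sqn => hx.
  rewrite -[sqn _]sqr_sqrtr ?sqn_ge0//.
  have -> : r / 4 = (Num.sqrt r / 2) ^+ 2 by rewrite exprMn sqr_sqrtr ?ltW//; field.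
  by apply: lerXn2r; rewrite ?nnegrE ?divr_ge0 ?sqrtr_ge0// ltW.
have ballr x : eball a (Num.sqrt r / 2) x -> sqn (x - a) <= r.
  by move=> /ballP; lra.
exists 4^-1; split; first lra.
exists (Num.sqrt r / 2); split.
- by rewrite divr_gt0// sqrtr_gt0.
- by move=> x /ballr /hr[].
- exists phi; split => //.
    by move=> _ [x /ballr /hr[_ [? _]] <-].
  (* The second constant bounds |U x|^2 by 2 |U x - U a|^2 + 2 |U a|^2, with the oscillation bound
     4. *)
  apply: (holder_norm_lt_pinfty _ _ K (2 * 4 + 2 * sqn (U a))) => //.
    move=> x /ballr hx; have := sqnD_le (U x - U a) (U a); rewrite subrK.
    have := osc x a hx; rewrite subrr sqn0 => /(_ (ltW r0)).
    rewrite /U; lra.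
  by move=> x y /ballP hx /ballP hy; exact: hK.
Qed.
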